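(* (1) The set $$\mathcal C:=\{(v_-,u,v_+)\in D(\mathcal L):\ v_+(0)\in\mathrm{Ran}\,\Gamma\}$$ is a core for $\mathcal L$, i.e. it is dense in $D(\mathcal L)$ in the graph norm. (2) The following are equivalent descriptions of $\mathcal C$: $$\mathcal C=\{(v_-,u,v_+)\in D(\mathcal L):\ v_-(0)\in\mathrm{Ran}\,\Gamma_*\};$$ $\mathcal C$ is the set of all $(v_-,u,v_+)\in\mathcal H$ with $v_-\in H^1(\mathbb R^-,E_* )$, $v_+\in H^1(\mathbb R^+,E)$ for which there exists $h\in D(A)$ such that $$h-iu\in D(A^* ),\qquad v_+(0)=\Gamma h,\qquad v_-(0)=\Gamma_*(h-iu);\qquad(\ast)$$ and $\mathcal C$ is the set of all $(v_-,u,v_+)\in\mathcal H$ with $v_-\in H^1(\mathbb R^-,E_* )$, $v_+\in H^1(\mathbb R^+,E)$ for which there exists $h_*\in D(A^* )$ such that $h_*+iu\in D(A)$, $v_-(0)=\Gamma_*h_*$ and $v_+(0)=\Gamma(h_*+iu)$. (3) For $(v_-,u,v_+)\in\mathcal C$ we have $$\mathcal L(v_-,u,v_+)=\big(iv_-',\ i[A^*(h-iu)-Ah],\ iv_+'\big),$$ where $h\in D(A)$ is as in $(\ast)$.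
   Context: Inner products are linear in the first argument. $\mathbb C^\pm=\{z:\pm\Im z>0\}$, $\mathbb R^-=(-\infty,0)$, $\mathbb R^+=(0,\infty)$. A densely defined operator $A$ in a Hilbert space $H$ is dissipative if $\Im\langle Ah,h\rangle\ge 0$ for all $h\in D(A)$, and maximal dissipative if it is dissipative and has no non-trivial dissipative extension; then $\mathbb C^-\subseteq\rho(A)$ and $\mathbb C^+\subseteq\rho(A^* )$. Throughout $A$ is a maximal dissipative operator on $H$. $E,E_*$ are Hilbert spaces and $\Gamma:D(A)\to E$, $\Gamma_*:D(A^* )\to E_*$ are fixed linear operators, bounded in the graph norms of $A$ and $A^*$ respectively, with dense ranges, such that $\langle Au,v\rangle-\langle u,Av\rangle=i\langle\Gamma u,\Gamma v\rangle_E$ for all $u,v\in D(A)$ and $\langle A^*u,v\rangle-\langle u,A^*v\rangle=-i\langle\Gamma_*u,\Gamma_*v\rangle_{E_*}$ for all $u,v\in D(A^* )$. (Any such choice is allowed.) For $z\in\rho(A^* )$, $S(z):E\to E_*$ is the bounded operator determined by $S(z)\Gamma u=\Gamma_*(A^*-z)^{-1}(A-z)u$ for $u\in D(A)$ (extended from $\mathrm{Ran}\,\Gamma$ to $E$ by continuity); $S^*(z)$ denotes $(S(z))^*$. The operator $\mathcal L$ on $\mathcal H=L^2(\mathbb R^-,E_* )\oplus H\oplus L^2(\mathbb R^+,E)$: fix $\mu\in\mathbb C^-$ and $\lambda\in\mathbb C^+$ (the definition does not depend on this choice). $D(\mathcal L)$ is the set of all $U=(v_-,u,v_+)\in\mathcal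 H$ such that $u\in H$, $v_+\in H^1(\mathbb R^+,E)$, $v_-\in H^1(\mathbb R^-,E_* )$, $u+(\Gamma_*(A^*+\mu)^{-1})^*v_-(0)\in D(A)$, $u+(\Gamma(A+\lambda)^{-1})^*v_+(0)\in D(A^* )$, and (I) $v_+(0)=S^*(-\mu)v_-(0)+i\Gamma\big(u+(\Gamma_*(A^*+\mu)^{-1})^*v_-(0)\big)$, (II) $v_-(0)=S(-\bar\lambda)v_+(0)-i\Gamma_*\big(u+(\Gamma(A+\lambda)^{-1})^*v_+(0)\big)$. For $U\in D(\mathcal L)$, $\mathcal L U=(iv_-',\,TU,\,iv_+')$, where $$TU=A^*\big(u+(\Gamma(A+\lambda)^{-1})^*v_+(0)\big)+\bar\lambda(\Gamma(A+\lambda)^{-1})^*v_+(0).$$ *)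

(* Defs.v *)
From HB Require Import structures.
From mathcomp Require Export all_boot all_order all_algebra.
From mathcomp Require Export complex sesquilinear.
From mathcomp Require Export all_classical all_reals all_analysis.
Export Order.TTheory GRing.Theory Num.Theory numFieldNormedType.Exports.

Set Implicit Arguments.
Unset Strict Implicit.
Unset Printing Implicit Defensive.

#[global] Open Scope classical_set_scope.
#[global] Open Scope ring_scope.

(* The inner product is linear in its first argument and conjugate-linear in
   its second one: this is the convention of {dot _ for _}. *)
Record hilbertType (R : realType) := HilbertType {
  hcarrier :> completeNormedModType R[i] ;
  ip : {dot hcarrier for Num.conj} ;
  normE : forall x : hcarrier, `|x| ^+ 2 = ip x x }.

Notation "''[' u , v ]" := (ip _ u v) : ring_scope.

(* The norm of a Hilbert space takes its values in R[i]; this is the same norm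
   as a real number. *)
Definition rnorm (R : realType) (K : hilbertType R) (x : K) : R :=
  complex.Re `|x|.

(* Unbounded operators in H. The values of act outside dom are irrelevant. *)
Record operator (R : realType) (H : hilbertType R) := Operator {
  dom : set H ;
  act :> H -> H }.

Definition linear_on (R : realType) (H K : hilbertType R) (D : set H)
    (T : H -> K) : Prop :=
  D 0 /\ forall (a : R[i]) (u v : H), D u -> D v ->
    D (a *: u + v) /\ T (a *: u + v) = a *: T u + T v.

Definition bounded_operator (R : realType) (H K : hilbertType R)
    (T : H -> K) : Prop :=
  linear_on setT T /\ exists M : R, forall u, rnorm (T u) <= M * rnorm u.

Section Operators.
Variables (R : realType) (H : hilbertType R).

Definition densely_defined (A : operator H) : Prop :=
  linear_on (dom A) A /\ dense (dom A).

Definition dissipative (A : operator H) : Prop :=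
  densely_defined A /\ forall h, dom A h -> 0 <= complex.Im '[A h, h].

Definition extends (B A : operator H) : Prop :=
  dom A `<=` dom B /\ forall u, dom A u -> B u = A u.

Definition maximal_dissipative (A : operator H) : Prop :=
  dissipative A /\
  forall B : operator H, dissipative B -> extends B A -> dom B = dom A.

(* For a densely defined A the vector chosen by get is unique. *)
Definition adjoint (A : operator H) : operator H :=
  let is_adj v w := forall u, dom A u -> '[A u, v] = '[u, w] in
  @Operator R H [set v | exists w, is_adj v w]
    (fun v => get [set w | is_adj v w]).

(* (A - z)^-1, for z in the resolvent set of A *)
Definition resolvent (A : operator H) (z : R[i]) (f : H) : H :=
  get [set u | dom A u /\ A u - z *: u = f].

(* Adjoint of an everywhere defined bounded operator. *)
Definition badjoint (K : hilbertType R) (T : H -> K) (y : K) : H :=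
  get [set x | forall h, '[T h, y] = '[h, x]].

(* Linear maps G : D(A) -> K, bounded in the graph norm of A, with dense range,
   such that <Au, v> - <u, Av> = c <Gu, Gv> on D(A). *)
Definition boundary_map (A : operator H) (c : R[i]) (K : hilbertType R)
    (G : H -> K) : Prop :=
  [/\ linear_on (dom A) G,
      exists M : R, forall u, dom A u ->
        rnorm (G u) <= M * Num.sqrt (rnorm u ^+ 2 + rnorm (A u) ^+ 2),
      dense (G @` dom A) &
      forall u v, dom A u -> dom A v ->
        '[A u, v] - '[u, A v] = c * '[G u, G v]].

End Operators.

Section HalfLines.
Variables (R : realType) (K : hilbertType R).

Let mu := @lebesgue_measure R.

(* Elements of L^2(D, K) are represented by functions R -> K whose values
   outside D are irrelevant; equality in L^2(D, K) is equality almost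
   everywhere on D. *)
Definition simple_function (s : R -> K) : Prop :=
  finite_set (range s) /\ forall y, measurable (s @^-1` [set y]).

Definition strongly_measurable (D : set R) (f : R -> K) : Prop :=
  exists s : nat -> R -> K, (forall n, simple_function (s n)) /\
    forall x, D x -> (fun n => s n x) @ \oo --> f x.

Definition L2norm2 (D : set R) (f : R -> K) : \bar R :=
  (\int[mu]_(x in D) (rnorm (f x) ^+ 2)%:E)%E.

Definition L2 (D : set R) : set (R -> K) :=
  [set f | strongly_measurable D f /\ (L2norm2 D f < +oo)%E].

Definition Cintegral (D : set R) (f : R -> R[i]) : R[i] :=
  (Rintegral mu D (fun x => complex.Re (f x)) +i*
   Rintegral mu D (fun x => complex.Im (f x)))%C.

(* For g in L^2(D, K): w(t) - w(s) is the integral of g over ]s, t[ for all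
   s <= t in the closure of D. The K-valued integral is the vector whose inner
   product with every e is the integral of <g, e>, which is the Bochner integral
   since g is norm-integrable on bounded intervals. *)
Definition primitive (D : set R) (w g : R -> K) : Prop :=
  forall s t, closure D s -> closure D t -> s <= t ->
    forall e : K, '[w t - w s, e] = Cintegral `]s, t[ (fun x => '[g x, e]).

(* f has an absolutely continuous representative w, up to the boundary of the
   interval D, with derivative g in L^2(D, K). *)
Definition H1_derivative (D : set R) (f w g : R -> K) : Prop :=
  [/\ L2 D g, {ae mu, forall x, D x -> f x = w x} & primitive D w g].

Definition H1 (D : set R) : set (R -> K) :=
  [set f | L2 D f /\ exists w g, H1_derivative D f w g].

(* Derivative of f in H^1(D, K), unique up to equality a.e. on D; all elements of
   the L^2-class of f get the same one. *)
Definition deriv (D : set R) (f : R -> K) : R -> K :=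
  get [set g | exists w, H1_derivative D f w g].

(* Boundary value f(0) of f in H^1(D, K), for D with 0 in its closure. *)
Definition trace0 (D : set R) (f : R -> K) : K :=
  get [set x | exists w g, H1_derivative D f w g /\ w 0 = x].

End HalfLines.

Definition Rneg {R : realType} : set R := `]-oo, 0[.
Definition Rpos {R : realType} : set R := `]0, +oo[.

Notation "v @0-" := (trace0 Rneg v) (at level 2) : ring_scope.
Notation "v @0+" := (trace0 Rpos v) (at level 2) : ring_scope.

Section FunctionalModel.
Variables (R : realType) (H E Es : hilbertType R).
Variables (A : operator H) (G : H -> E) (Gs : H -> Es).

Local Notation As := (adjoint A).

(* S(z), for z in the resolvent set of A^* *)
Definition characteristic_function (z : R[i]) : E -> Es :=
  get [set T : E -> Es | bounded_operator T /\
    forall u, dom A u -> T (G u) = Gs (resolvent As z (A u - z *: u))].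

Local Notation S := characteristic_function.

(* (Gs (A^* + m)^-1)^* and (G (A + l)^-1)^*; m in C^- and l in C^+ are the
   parameters mu and lambda of the definition of the operator calL. *)
Definition Gs_radj (m : R[i]) : Es -> H :=
  badjoint (fun f => Gs (resolvent As (- m) f)).
Definition G_radj (l : R[i]) : E -> H :=
  badjoint (fun f => G (resolvent A (- l) f)).

(* Triples (v_-, u, v_+), see L2 for the representation of v_- and v_+. *)
Local Notation triple := ((R -> Es) * H * (R -> E))%type.

Definition calH : set triple :=
  [set U | let: (vm, u, vp) := U in L2 Rneg vm /\ L2 Rpos vp].

Definition calHnorm2 (U : triple) : \bar R :=
  let: (vm, u, vp) := U in
  (L2norm2 Rneg vm + (rnorm u ^+ 2)%:E + L2norm2 Rpos vp)%E.

Definition calL_dom (m l : R[i]) : set triple :=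
  [set U | let: (vm, u, vp) := U in
    [/\ calH U, H1 Rneg vm, H1 Rpos vp,
      dom A (u + Gs_radj m vm@0-) /\ dom As (u + G_radj l vp@0+) &
      vp@0+ = badjoint (S (- m)) vm@0- + 'i *: G (u + Gs_radj m vm@0-) /\
      vm@0- = S (- Num.conj l) vp@0+ - 'i *: Gs (u + G_radj l vp@0+)]].

Definition calL (m l : R[i]) (U : triple) : triple :=
  let: (vm, u, vp) := U in
  ('i *: deriv Rneg vm,
   As (u + G_radj l vp@0+) + Num.conj l *: G_radj l vp@0+,
   'i *: deriv Rpos vp).

(* Density is for the graph norm, (|U|^2 + |L U|^2)^(1/2). *)
Definition is_core (DL : set triple) (L : triple -> triple)
    (C : set triple) : Prop :=
  C `<=` DL /\
  forall U, DL U -> forall eps : R, 0 < eps ->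
    exists2 V, C V &
      (calHnorm2 (U - V)%R + calHnorm2 (L U - L V)%R < (eps ^+ 2)%:E)%E.

Definition calC (m l : R[i]) : set triple :=
  [set U | calL_dom m l U /\ let: (_, _, vp) := U in (G @` dom A) vp@0+].

Definition calC_minus (m l : R[i]) : set triple :=
  [set U | calL_dom m l U /\ let: (vm, _, _) := U in (Gs @` dom As) vm@0-].

Definition star_rel (U : triple) (h : H) : Prop :=
  let: (vm, u, vp) := U in
  [/\ dom A h, dom As (h - 'i *: u), vp@0+ = G h & vm@0- = Gs (h - 'i *: u)].

Definition star_rel' (U : triple) (hs : H) : Prop :=
  let: (vm, u, vp) := U in
  [/\ dom As hs, dom A (hs + 'i *: u), vm@0- = Gs hs & vp@0+ = G (hs + 'i *: u)].

Definition H1_triples : set triple :=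
  [set U | let: (vm, u, vp) := U in [/\ calH U, H1 Rneg vm & H1 Rpos vp]].

End FunctionalModel.

(* Main.v *)
Require Import Defs.
From mathcomp Require Import measurable_realfun ring lra.

Import HBSimple.

Set Implicit Arguments.
Unset Strict Implicit.
Unset Printing Implicit Defensive.

(** Everything rests on evaluating the boundary terms of the domain of calL on
    the ranges of G and Gs. For h in D(A) let k be the solution of
    (adjoint A + conj l) k = (A + conj l) h. Green's formula gives

      (adjoint of G (A + l)^-1) (G h) = i (h - k),   S(- conj l) (G h) = Gs k,

    the lemma G_radj_range. When v_+(0) = G h, the element k cancels, and the
    requirement on adjoint A together with (II) becomes: h - i u is in the
    domain of the adjoint and v_-(0) = Gs (h - i u); this is star_right. In the
    same way, when v_-(0) = Gs hs, the requirement on A together with (I)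
    becomes: hs + i u is in D(A) and v_+(0) = G (hs + i u); this is star_left.
    The two conclusions are the same statement under hs = h - i u. So on the
    range of G one half of the definition of the domain implies the other, and
    the four descriptions of calC agree. Inserting the same formulas in the
    definition of calL gives its expression through h, the lemma calL_star.

    For the core property, let U = (v_-, u, v_+) be in the domain and keep
    p = u + (adjoint of G (A + l)^-1) v_+(0). Since G has dense range, v_+(0) is
    close to some G h. Solving back for u, and taking v_-(0) from (II), moves
    both, as well as the middle component of the image, by bounded operators
    applied to G h - v_+(0). The functions v_- and v_+ are corrected by a
    multiple of a fixed piecewise linear bump, which costs no more than the
    displacement of the trace (H1_shift). The new triple satisfies the half of
    the domain conditions that star_right needs, hence belongs to calC.

    Three foundations are built for this. The resolvents exist at the points
    where they are used: maximality says that a pair which keeps the graph of A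
    dissipative belongs to it (maximal_dissipativeP), and this yields both
    density and closedness of the range of A - z for Im z < 0. The
    characteristic function exists since its defining relation is contractive
    (characteristic_contraction, extend_dense), and bounded adjoints exist by the
    Riesz representation (riesz_on). Finally, traces and derivatives, which are
    chosen among representatives, are unique (primitive_eq0), so they can be
    computed from any representative. *)

(** * Hilbert spaces and minimisation of quadratic functionals *)

Section Hilbert.
Variables (R : realType) (K : hilbertType R).
Implicit Types (x y z : K) (a b : R[i]).

Lemma ipC x y : '[x, y] = Num.conj '[y, x].
Proof. by rewrite hermC expr0 mul1r. Qed.
Lemma ipDl x y z : '[x + y, z] = '[x, z] + '[y, z].
Proof. exact: linearDl. Qed.
Lemma ipDr x y z : '[x, y + z] = '[x, y] + '[x, z].
Proof. exact: linearDr. Qed.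
Lemma ipBl x y z : '[x - y, z] = '[x, z] - '[y, z].
Proof. exact: linearBl. Qed.
Lemma ipBr x y z : '[x, y - z] = '[x, y] - '[x, z].
Proof. exact: linearBr. Qed.
Lemma ipZl a x y : '[a *: x, y] = a * '[x, y].
Proof. exact: linearZl_LR. Qed.
Lemma ipZr a x y : '[x, a *: y] = Num.conj a * '[x, y].
Proof. exact: linearZr_LR. Qed.
Lemma ip0l x : '[0 : K, x] = 0.
Proof. exact: linear0l. Qed.
Lemma ip0r x : '[x, 0 : K] = 0.
Proof. exact: linear0r. Qed.

Lemma ReD a b : complex.Re (a + b) = complex.Re a + complex.Re b.
Proof. by case: a b => ? ? []. Qed.
Lemma ReB a b : complex.Re (a - b) = complex.Re a - complex.Re b.
Proof. by case: a b => ? ? []. Qed.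
Lemma ImD a b : complex.Im (a + b) = complex.Im a + complex.Im b.
Proof. by case: a b => ? ? []. Qed.
Lemma ImB a b : complex.Im (a - b) = complex.Im a - complex.Im b.
Proof. by case: a b => ? ? []. Qed.
Lemma ReM a b : complex.Re (a * b) =
  complex.Re a * complex.Re b - complex.Im a * complex.Im b.
Proof. by case: a b => ? ? []. Qed.
Lemma ImM a b : complex.Im (a * b) =
  complex.Re a * complex.Im b + complex.Im a * complex.Re b.
Proof. by case: a b => ? ? [] *; rewrite /= addrC [X in X + _]mulrC addrC. Qed.
Lemma Re_conj a : complex.Re (Num.conj a) = complex.Re a.
Proof. by case: a. Qed.
Lemma Im_conj a : complex.Im (Num.conj a) = - complex.Im a.
Proof. by case: a. Qed.
Lemma ReN a : complex.Re (- a) = - complex.Re a.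
Proof. by case: a. Qed.
Lemma ImN a : complex.Im (- a) = - complex.Im a.
Proof. by case: a. Qed.
Lemma Re_i : complex.Re ('i : R[i]) = 0.
Proof. by rewrite -complexiE. Qed.
Lemma Im_i : complex.Im ('i : R[i]) = 1.
Proof. by rewrite -complexiE. Qed.
Definition ReImE := (ReD, ReB, ImD, ImB, ReM, ImM, Re_conj, Im_conj, ReN, ImN,
  Re_i, Im_i).
Lemma eq_ReIm a b : complex.Re a = complex.Re b -> complex.Im a = complex.Im b -> a = b.
Proof. by case: a b => ? ? [? ?] /= -> ->. Qed.

Lemma norm_rnorm x : `|x| = (rnorm x)%:C%C.
Proof. by rewrite /rnorm; have := ger0_Im (normr_ge0 x); case: `|x| => p q /= ->. Qed.

Lemma rnorm_ge0 x : 0 <= rnorm x.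
Proof. by have := normr_ge0 x; rewrite norm_rnorm ler0c. Qed.

Lemma ipxx x : '[x, x] = (rnorm x ^+ 2)%:C%C.
Proof. by rewrite -normE norm_rnorm rmorphXn. Qed.

Lemma Re_ipxx x : complex.Re '[x, x] = rnorm x ^+ 2.
Proof. by rewrite ipxx. Qed.
Lemma Im_ipxx x : complex.Im '[x, x] = 0.
Proof. by rewrite ipxx. Qed.
Lemma Re_ipC x y : complex.Re '[x, y] = complex.Re '[y, x].
Proof. by rewrite ipC Re_conj. Qed.

Lemma rnormD x y : rnorm (x + y) <= rnorm x + rnorm y.
Proof. by rewrite -lecR rmorphD /= -!norm_rnorm ler_normD. Qed.
Lemma rnormN x : rnorm (- x) = rnorm x.
Proof. by rewrite /rnorm normrN. Qed.
Lemma rnormC x y : rnorm (x - y) = rnorm (y - x).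
Proof. by rewrite -rnormN opprB. Qed.
Lemma rnorm0 : rnorm (0 : K) = 0.
Proof. by rewrite /rnorm normr0. Qed.
Lemma rnorm_eq0 x : rnorm x = 0 -> x = 0.
Proof. by move=> h; apply/eqP; rewrite -normr_eq0 norm_rnorm h. Qed.
Lemma rnormZ a x : rnorm (a *: x) = Normc.normc a * rnorm x.
Proof. by apply: complexI; rewrite rmorphM /= -!norm_rnorm normrZ. Qed.

Lemma rnorm2D x y :
  rnorm (x + y) ^+ 2 = rnorm x ^+ 2 + rnorm y ^+ 2 + 2 * complex.Re '[x, y].
Proof.
rewrite -!Re_ipxx ipDl !ipDr !ReImE (Re_ipC y x); ring.
Qed.
Lemma rnorm2B x y :
  rnorm (x - y) ^+ 2 = rnorm x ^+ 2 + rnorm y ^+ 2 - 2 * complex.Re '[x, y].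
Proof.
rewrite -!Re_ipxx ipBl !ipBr !ReImE (Re_ipC y x); ring.
Qed.

Lemma normc_ge0 a : 0 <= Normc.normc a.
Proof. by case: a => p q; rewrite sqrtr_ge0. Qed.
Lemma normc2 a : Normc.normc a ^+ 2 = complex.Re a ^+ 2 + complex.Im a ^+ 2.
Proof. by case: a => p q /=; rewrite sqr_sqrtr // addr_ge0 ?sqr_ge0. Qed.
Lemma normc_conj a : Normc.normc (Num.conj a) = Normc.normc a.
Proof. by case: a => p q /=; rewrite sqrrN. Qed.
Lemma ler_Re_normc a : complex.Re a <= Normc.normc a.
Proof.
rewrite (le_trans (ler_norm _)) // -(@ler_pXn2r _ 2) ?nnegrE ?normc_ge0 //.
by rewrite real_normK ?num_real // normc2 lerDl sqr_ge0.
Qed.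

(** Cauchy-Schwarz: expand the squared norm of |y| x - |x| y. *)
Lemma Re_ip_le x y : complex.Re '[x, y] <= rnorm x * rnorm y.
Proof.
have [/rnorm_eq0 ->|x0] := eqVneq (rnorm x) 0.
  by rewrite ip0l rnorm0 mul0r.
have [/rnorm_eq0 ->|y0] := eqVneq (rnorm y) 0.
  by rewrite ip0r rnorm0 mulr0.
have x1 : 0 < rnorm x by rewrite lt_def x0 rnorm_ge0.
have y1 : 0 < rnorm y by rewrite lt_def y0 rnorm_ge0.
have := sqr_ge0 (rnorm ((rnorm y)%:C%C *: x - (rnorm x)%:C%C *: y)).
rewrite rnorm2B !rnormZ /= !expr0n /= !addr0 !sqrtr_sqr !ger0_norm ?rnorm_ge0 //.
rewrite ipZl ipZr !ReImE /= => h.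
have : 0 <= 2 * (rnorm x * rnorm y) * (rnorm x * rnorm y - complex.Re '[x, y]).
  by apply: le_trans h _; rewrite le_eqVlt; apply/orP; left; apply/eqP; ring.
rewrite pmulr_rge0 ?subr_ge0 //.
by rewrite mulr_gt0 // mulr_gt0.
Qed.

(** The real case, applied after rotating the product onto the positive axis. *)
Lemma normc_ip_le x y : Normc.normc '[x, y] <= rnorm x * rnorm y.
Proof.
have [->|n0] := eqVneq (Normc.normc '[x, y]) 0.
  by rewrite mulr_ge0 ?rnorm_ge0.
have := Re_ip_le (Num.conj '[x, y] *: x) y.
rewrite ipZl rnormZ normc_conj !ReImE.
have -> : complex.Re '[x, y] * complex.Re '[x, y] -
  - complex.Im '[x, y] * complex.Im '[x, y] = Normc.normc '[x, y] ^+ 2.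
  by rewrite normc2; ring.
rewrite expr2 -mulrA ler_pM2l // lt_def n0; exact: normc_ge0.
Qed.

Lemma ip_eqP x y : (forall z, '[z, x] = '[z, y]) -> x = y.
Proof.
move=> h; apply/subr0_eq/rnorm_eq0/eqP; rewrite -sqrf_eq0 -Re_ipxx ipBr.
by rewrite h subrr.
Qed.

Lemma ip_eqPl x y : (forall z, '[x, z] = '[y, z]) -> x = y.
Proof. by move=> h; apply: ip_eqP => z; rewrite ipC h -ipC. Qed.
Lemma ipNl x y : '[- x, y] = - '[x, y].
Proof. exact: linearNl. Qed.

(** Limits are taken here along real accuracies: P e x reads as x being an
    approximation with error e of the vector to be found, so no sequence has to
    be named where this is applied. *)
Lemma complete_approx (P : R -> K -> Prop) (C : R) :
  (forall e : R, 0 < e -> exists x, P e x) ->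
  (forall (e d : R) x y, 0 < e -> 0 < d -> P e x -> P d y ->
     rnorm (x - y) <= C * (e + d)) ->
  exists y, forall e : R, 0 < e ->
    exists (d : R) x, [/\ 0 < d, d <= e, P d x & rnorm (x - y) <= e].
Proof.
move=> Pex PC.
have e0 n : (0 : R) < n.+1%:R^-1 by rewrite invr_gt0.
have /choice[x Px] : forall n, exists x, P n.+1%:R^-1 x by move=> n; exact: Pex.
have small (e : R) : 0 < e -> exists N, forall n, (N <= n)%N -> n.+1%:R^-1 <= e.
  move=> ep; have [N] := ltr_add_invr ep; rewrite add0r => hN; exists N => n Nn.
  by apply: le_trans (ltW hN); rewrite lef_pV2 ?posrE ?ltr0n // ler_nat ltnS.
have C0 : 0 <= C.
  have := PC _ _ _ _ (e0 0%N) (e0 0%N) (Px 0%N) (Px 0%N).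
  by rewrite subrr rnorm0 invr1 pmulr_lge0.
have cx : cvg (x @ \oo).
  apply: cauchy_cvg; apply: cauchy_exP => /= -[e e'].
  rewrite ltcE /= => /andP[/eqP -> ep].
  have [|N hN] := small (e / (2 * C + 1) / 2).
    by rewrite !divr_gt0 // ltr_wpDl // mulr_ge0.
  exists (x N), N => // n /= Nn; rewrite -ball_normE /ball_ /=.
  rewrite norm_rnorm ltcR.
  apply: le_lt_trans (PC _ _ _ _ (e0 _) (e0 _) (Px _) (Px _)) _.
  have h1 := hN _ (leqnn N); have h2 := hN _ Nn.
  set q := e / (2 * C + 1) in h1 h2.
  have q0 : 0 < q by rewrite divr_gt0 // ltr_wpDl // mulr_ge0.
  have -> : e = q * (2 * C + 1).
    by rewrite /q divfK // gt_eqF // ltr_wpDl // mulr_ge0.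
  apply: le_lt_trans (ler_wpM2l C0 (lerD h1 h2)) _.
  have : 0 <= C * q by rewrite mulr_ge0 // ltW.
  by move=> ?; nra.
exists (lim (x @ \oo)) => e ep.
have [N hN] := small e ep.
have /cvgrPdist_le/(_ (e%:C)%C) := cx.
rewrite ltcR => /(_ ep) [M _ hM].
exists (maxn N M).+1%:R^-1, (x (maxn N M)); split => //.
  by rewrite hN // leq_maxl.
rewrite rnormC -lecR -norm_rnorm; apply: hM; exact: leq_maxr.
Qed.

Definition subspace (V : set K) :=
  V 0 /\ forall a x y, V x -> V y -> V (a *: x + y).

Definition functional_on (V : set K) (f : K -> R[i]) :=
  (forall a x y, V x -> V y -> f (a *: x + y) = a * f x + f y) /\
  exists M : R, forall x, V x -> Normc.normc (f x) <= M * rnorm x.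

(** First variation at a minimum: a linear term dominated by a quadratic one
    vanishes. *)
Lemma linear_le_quadratic (b c : R) : (forall t, b * t <= t ^+ 2 * c) -> b = 0.
Proof.
move=> h; have c0 : 0 <= c.
  have := h 1; have := h (-1); rewrite sqrrN expr1n !mul1r mulrN mulr1 => h1 h2.
  by lra.
apply: contrapT => /eqP b0; have c1 : 0 < 2 * (c + 1) by lra.
have := h (b / (2 * (c + 1))).
have -> : b * (b / (2 * (c + 1))) = (b / (2 * (c + 1))) ^+ 2 * (2 * (c + 1)).
  by field; lra.
have t0 : 0 < (b / (2 * (c + 1))) ^+ 2.
  by rewrite exprn_even_gt0 //= mulf_neq0 // invr_eq0 gt_eqF.
rewrite ler_pM2l //; lra.
Qed.

(** The same when the minimum is only approached, with an error that is uniform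
    up to the growth of the quadratic term. *)
Lemma linear_le_quadratic_approx (b c : R) :
  (forall t e : R, 0 < e -> b * t <= t ^+ 2 * c + (t ^+ 2 + 1) * e) -> b = 0.
Proof.
move=> h; apply: (@linear_le_quadratic _ c) => t; apply/ler_addgt0Pr => e e0.
have t0 : 0 < t ^+ 2 + 1 by rewrite ltr_wpDl // sqr_ge0.
have := h t (e / (t ^+ 2 + 1)); rewrite divr_gt0 // => /(_ isT).
by rewrite mulrC [in X in _ <= X -> _]mulrC [_ * (e / _)]mulrC divfK ?gt_eqF //
  mulrC (mulrC c).
Qed.

(** Minimise |x|^2 - 2 Re (f x) over V: the parallelogram identity makes
    minimising families Cauchy, and the first variation at the limit gives f. As
    V need not be closed, y is only a limit of points of V. For V = K this is
    the Riesz representation theorem; for f = <., g> it is the projection of g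
    onto the closure of V. *)
Lemma riesz_on (V : set K) (f : K -> R[i]) :
  subspace V -> functional_on V f ->
  exists y, (forall e : R, 0 < e -> exists2 x, V x & rnorm (x - y) <= e) /\
    forall x, V x -> f x = '[x, y].
Proof.
move=> [V0 VP] [fP [M fM]].
pose J x := rnorm x ^+ 2 - 2 * complex.Re (f x).
have M0 : 0 <= `|M| by [].
have Jlb x : V x -> - `|M| ^+ 2 <= J x.
  move=> Vx; rewrite /J.
  have := ler_Re_normc (f x); have := fM _ Vx.
  have := ler_wpM2r (rnorm_ge0 x) (ler_norm M).
  have := sqr_ge0 (rnorm x - `|M|); nra.
pose S := [set J x | x in V].
have hS : has_inf S.
  split; first by exists (J 0), 0.
  by exists (- `|M| ^+ 2) => _ [x Vx <-]; exact: Jlb.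
pose d := inf S.
have dJ x : V x -> d <= J x.
  by move=> Vx; apply: ge_inf; [exact: hS.2 | exists x].
have JE x v t : V x -> V v ->
    J (t *: v + x) = J x + Normc.normc t ^+ 2 * rnorm v ^+ 2 +
      2 * complex.Re (t * ('[v, x] - f v)).
  move=> Vx Vv; rewrite /J fP // rnorm2D rnormZ ipZl exprMn !ReImE.
  by ring.
(* an excess of e^2 over the infimum makes the distances linear in e *)
have [|e e' x y e0 e'0 [Vx Jx] [Vy Jy]|y yP] :=
    @complete_approx (fun e x => V x /\ J x <= d + e ^+ 2) 2.
- move=> e e0; have [_ [x Vx <-] /ltW xe] := inf_adherent (exprn_gt0 2 e0) hS.
  by exists x.
- have VD : V (y - x) by rewrite -scaleN1r addrC; apply: VP.
  have := dJ _ (VP (2^-1)%:C%C _ _ VD Vx).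
  rewrite JE //; have := JE x (y - x) 1 Vx VD.
  rewrite scale1r subrK mul1r !ReImE !normc2 /=.
  set N := rnorm (y - x); set r := complex.Re '[_, _] - _.
  rewrite rnormC -/N !expr0n !expr1n /= !addr0 !mul0r subr0 => Jyx dm.
  rewrite -(@ler_pXn2r _ 2) ?nnegrE ?rnorm_ge0 //; last by rewrite mulr_ge0 //; lra.
  have : 0 <= e * e' by rewrite mulr_ge0 // ltW.
  by rewrite exprMn; nra.
exists y; split.
  by move=> e e0; have [d' [x [_ _ [Vx _] xy]]] := yP e e0; exists x.
have Rr v : V v -> complex.Re ('[v, y] - f v) = 0.
  move=> Vv; apply: (@linear_le_quadratic_approx _ (rnorm v ^+ 2)) => t e e0.
  have v0 := rnorm_ge0 v.
  pose h := Num.min 1 (e / (rnorm v + 1)).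
  have h0 : 0 < h by rewrite lt_min ltr01 divr_gt0 // ltr_wpDl.
  have h1 : h <= 1 by rewrite ge_min lexx.
  have h2 : h * (rnorm v + 1) <= e.
    by rewrite -ler_pdivlMr ?ltr_wpDl // ge_min lexx orbT.
  have [d' [x [d0 d'h [Vx Jx] xy]]] := yP h h0.
  have := dJ _ (VP (t / -2)%:C%C _ _ Vv Vx); rewrite JE // normc2 !ReImE /= => dm.
  have h3 : complex.Re '[v, x] - complex.Re '[v, y] <= rnorm v * h.
    by rewrite -ReB -ipBr (le_trans (Re_ip_le _ _)) // ler_wpM2l.
  have h4 : complex.Re '[v, y] - complex.Re '[v, x] <= rnorm v * h.
    by rewrite -ReB -ipBr (le_trans (Re_ip_le _ _)) // ler_wpM2l // rnormC.
  move: (complex.Re '[v, x]) (complex.Re '[v, y]) (complex.Re (f v)) dm h3 h4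
    => p q r dm h3 h4.
  have tb : t * (q - p) <= (t ^+ 2 + 1) * (rnorm v * h).
    have : `|t * (q - p)| <= `|t| * (rnorm v * h).
      by rewrite normrM ler_wpM2l // ler_norml; apply/andP; split; lra.
    move/(le_trans (ler_norm _)) => /le_trans; apply.
    apply: ler_wpM2r; first by rewrite mulr_ge0 // ltW.
    by rewrite -real_normK ?num_real //; have := sqr_ge0 (`|t| - 1); nra.
  have t1 : 0 < t ^+ 2 + 1 by rewrite ltr_wpDl // sqr_ge0.
  have th : (t ^+ 2 + 1) * (rnorm v * h + h ^+ 2) <= (t ^+ 2 + 1) * e.
    rewrite ler_pM2l //; apply: le_trans h2.
    by rewrite mulrDr mulr1 mulrC lerD2l expr2 ler_piMl // ltW.
  have : d' ^+ 2 <= h ^+ 2 by rewrite ler_pXn2r // nnegrE ltW.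
  have : 0 <= t ^+ 2 * h ^+ 2 by rewrite mulr_ge0 // sqr_ge0.
  have : 0 <= t ^+ 2 * rnorm v ^+ 2 by rewrite mulr_ge0 // sqr_ge0.
  lra.
(* the imaginary part is the real part at 'i *: v *)
have Rri v : V v -> '[v, y] - f v = 0.
  move=> Vv; apply: eq_ReIm; first exact: Rr.
  have Viv : V ('i *: v + 0) by apply: VP.
  have := Rr _ Viv; rewrite fP // addr0 ipZl -[X in _ - X]addr0.
  have -> : f 0 = 0.
    by have := fP 1 0 0 V0 V0; rewrite scale1r mul1r addr0 -{1}[f 0]addr0 => /addrI.
  rewrite !ReImE /=; lra.
by move=> x Vx; apply/esym/subr0_eq; exact: Rri.
Qed.
End Hilbert.

(** Identities between linear combinations of vectors are identities in the
    scalar field once paired with an arbitrary vector. *)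
Ltac ip_ring := apply: ip_eqPl => ?;
  rewrite ?(ipBl, ipDl, ipNl, ipZl, ip0l); ring.

(** The same modulo 'i ^+ 2 = -1. *)
Ltac ip_ring_i R := apply: ip_eqPl => ?;
  rewrite ?(ipBl, ipDl, ipNl, ipZl, ip0l); ring: (sqrCi (complex R)).

(** * Bounded operators, density and extension by continuity *)

Section Linear.
Variables (R : realType) (H K : hilbertType R).

Lemma linear_on_ind (D : set H) (T : H -> K) : linear_on D T ->
  [/\ D 0 /\ T 0 = 0,
      forall u v, D u -> D v -> D (u + v) /\ T (u + v) = T u + T v,
      forall u v, D u -> D v -> D (u - v) /\ T (u - v) = T u - T v &
      forall a u, D u -> D (a *: u) /\ T (a *: u) = a *: T u].
Proof.
move=> [D0 DP].
have T0 : T 0 = 0.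
  have [_] := DP 1 0 0 D0 D0; rewrite !scale1r addr0 -{1}[T 0]addr0.
  by move/addrI/esym.
split=> // [u v Du Dv|u v Du Dv|a u Du].
- by have := DP 1 u v Du Dv; rewrite !scale1r.
- by have := DP (-1) v u Dv Du; rewrite !scaleN1r ![- _ + _]addrC.
- by have := DP a u 0 Du D0; rewrite T0 !addr0.
Qed.

Lemma bounded_operator_lin (T : H -> K) : bounded_operator T ->
  forall a u v, T (a *: u + v) = a *: T u + T v.
Proof. by move=> [[_ TP] _] a u v; have [] := TP a u v. Qed.

Lemma bounded_operatorB (T : H -> K) : bounded_operator T ->
  forall u v, T (u - v) = T u - T v.
Proof. by move=> [/linear_on_ind[_ _ TB _] _] u v; have [] := TB u v. Qed.

Lemma bounded_operator_le (T : H -> K) : bounded_operator T ->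
  exists2 M : R, 0 <= M & forall u, rnorm (T u) <= M * rnorm u.
Proof.
move=> [_ [M TM]]; exists `|M| => // u; apply: le_trans (TM u) _.
by rewrite ler_wpM2r ?rnorm_ge0 // ler_norm.
Qed.

(** Existence is the Riesz representation of <T ., y>. *)
Lemma badjointP (T : H -> K) : bounded_operator T ->
  forall x y, '[T x, y] = '[x, badjoint T y].
Proof.
move=> Tb x y; have TP := bounded_operator_lin Tb.
have [M M0 TM] := bounded_operator_le Tb.
suff : exists z, forall h, '[T h, y] = '[h, z].
  by move=> ex; apply: (@getPex _ [set z | forall h, '[T h, y] = '[h, z]] ex).
have [||z [_ zP]] := @riesz_on R H setT (fun x => '[T x, y]).
- by [].
- split=> [a u v _ _|]; first by rewrite TP ipDl ipZl.
  exists (M * rnorm y) => u _; apply: le_trans (normc_ip_le _ _) _.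
  by rewrite mulrAC ler_wpM2r // rnorm_ge0.
- by exists z => h; rewrite zP.
Qed.
End Linear.

Section BoundedAdjoint.
Variables (R : realType) (H K : hilbertType R).

Lemma badjoint_bounded (T : H -> K) : bounded_operator T ->
  bounded_operator (badjoint T).
Proof.
move=> Tb; have TP := badjointP Tb; have [M M0 TM] := bounded_operator_le Tb.
split.
  split=> // a u v _ _; split=> //; apply: ip_eqP => z.
  by rewrite -TP !ipDr !ipZr !TP.
exists M => y; have [->|n0] := eqVneq (rnorm (badjoint T y)) 0.
  by rewrite mulr_ge0 // rnorm_ge0.
have n1 : 0 < rnorm (badjoint T y) by rewrite lt_def n0 rnorm_ge0.
rewrite -(ler_pM2l n1) -expr2 -Re_ipxx -TP.
apply: le_trans (Re_ip_le _ _) _.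
by rewrite mulrA (mulrC _ M) ler_wpM2r // rnorm_ge0.
Qed.

Lemma dense_approx (D : set K) : dense D ->
  forall x (e : R), 0 < e -> exists2 y, D y & rnorm (y - x) < e.
Proof.
move=> Dd x e e0; have e0' : (0 : R[i]) < (e%:C)%C by rewrite ltcR.
have [|y [xy Dy]] := Dd (ball x (e%:C)%C) _ (ball_open x _).
  by exists x; exact: ballxx.
by exists y => //; move: xy; rewrite -ball_normE /ball_ /= norm_rnorm ltcR rnormC.
Qed.

Lemma ip_approx0 (D : set K) y : (forall x, D x -> '[x, y] = 0) ->
  (forall e : R, 0 < e -> exists2 x, D x & rnorm (x - y) <= e) -> y = 0.
Proof.
move=> yD yA; apply/rnorm_eq0/eqP; rewrite eq_le rnorm_ge0 andbT.
apply/ler_addgt0Pr => e e0; rewrite add0r; have [x Dx xe] := yA e e0.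
have : rnorm (x - y) ^+ 2 <= e ^+ 2.
  by rewrite ler_pXn2r ?nnegrE ?rnorm_ge0 // ltW.
rewrite rnorm2B yD // mulr0 subr0 => h.
rewrite -(@ler_pXn2r _ 2) ?nnegrE ?rnorm_ge0 //; last exact: ltW.
by apply: le_trans h; rewrite lerDr sqr_ge0.
Qed.

Lemma dense_orth (D : set K) y : dense D -> (forall x, D x -> '[x, y] = 0) ->
  y = 0.
Proof.
move=> Dd yD; apply: (ip_approx0 yD) => e e0.
by have [x Dx xy] := dense_approx Dd y e0; exists x => //; exact: ltW.
Qed.

(** The error g - y of the projection y of g is orthogonal to V. *)
Lemma orth_dense (V : set K) : subspace V ->
  (forall y, (forall x, V x -> '[x, y] = 0) -> y = 0) ->
  forall g (e : R), 0 < e -> exists2 x, V x & rnorm (x - g) <= e.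
Proof.
move=> Vs Vo g.
have [|y [yA yP]] := @riesz_on R K V (fun x => '[x, g]) Vs.
  split=> [a u v _ _|]; first by rewrite ipDl ipZl.
  by exists (rnorm g) => u _; rewrite mulrC normc_ip_le.
suff /subr0_eq -> : g - y = 0 by [].
by apply: Vo => x Vx; rewrite ipBr yP // subrr.
Qed.

(** Extension by continuity of a contraction given by its graph. Starting from a
    relation spares a proof that the operator is well defined on its initial
    domain: the norm bound gives that too. *)
Lemma extend_dense (rel : H -> K -> Prop) :
  (forall a x y x' y', rel x y -> rel x' y' -> rel (a *: x + x') (a *: y + y')) ->
  (forall x y, rel x y -> rnorm y <= rnorm x) ->
  (forall x (e : R), 0 < e -> exists x' y, rel x' y /\ rnorm (x' - x) <= e) ->
  exists T, bounded_operator T /\ forall x y, rel x y -> T x = y.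
Proof.
move=> rP rB rD.
pose cl x y := forall e : R, 0 < e ->
  exists x' y', [/\ rel x' y', rnorm (x' - x) <= e & rnorm (y' - y) <= e].
have rBB x y x' y' : rel x y -> rel x' y' -> rnorm (y - y') <= rnorm (x - x').
  by move=> r r'; have := rB _ _ (rP (-1) _ _ _ _ r' r);
    rewrite !scaleN1r ![- _ + _]addrC.
have tri (L : hilbertType R) (a b c : L) :
    rnorm (a - b) <= rnorm (a - c) + rnorm (b - c).
  by rewrite (rnormC b) (le_trans _ (rnormD _ _)) // addrA subrK.
have clex x : exists y, cl x y.
  have [|e e' y y' e0 e'0|y yP] := @complete_approx R K
      (fun e y => exists2 x', rel x' y & rnorm (x' - x) <= e) 1.
  - by move=> e e0; have [x' [y [r h]]] := rD x e e0; exists y, x'.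
  - move=> [u ru ue] [u' ru' ue']; rewrite mul1r.
    apply: le_trans (rBB _ _ _ _ ru ru') _; apply: le_trans (tri _ _ _ x) _.
    exact: lerD.
  exists y => e e0; have [d [y' [d0 de [x' r h] h']]] := yP e e0.
  by exists x', y'; split => //; apply: le_trans de.
have cllin a x y x' y' : cl x y -> cl x' y' -> cl (a *: x + x') (a *: y + y').
  move=> c c' e e0; have n0 := normc_ge0 a.
  have d0 : 0 < e / (Normc.normc a + 1) by rewrite divr_gt0 // ltr_wpDl.
  have [u [v [r h1 h2]]] := c _ d0; have [u' [v' [r' h1' h2']]] := c' _ d0.
  have hh : Normc.normc a * (e / (Normc.normc a + 1)) +
      e / (Normc.normc a + 1) = e by field; lra.
  have aux (L : hilbertType R) (p q p' q' : L) :
      rnorm (p - q) <= e / (Normc.normc a + 1) ->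
      rnorm (p' - q') <= e / (Normc.normc a + 1) ->
      rnorm ((a *: p + p') - (a *: q + q')) <= e.
    move=> k k'; rewrite opprD addrACA -scalerBr.
    apply: le_trans (rnormD _ _) _; rewrite rnormZ -[leRHS]hh lerD //.
    by rewrite ler_wpM2l.
  by exists (a *: u + u'), (a *: v + v'); split; [exact: rP|exact: aux|exact: aux].
have clB x y : cl x y -> rnorm y <= rnorm x.
  move=> c; apply/ler_addgt0Pr => e e0.
  have [|u [v [r h1 h2]]] := c (e / 2); first by rewrite divr_gt0.
  have := rB _ _ r.
  have := rnormD v (y - v); have := rnormD x (u - x).
  rewrite [x + _]addrC [v + _]addrC !subrK (rnormC y); lra.
have clU x y y' : cl x y -> cl x y' -> y = y'.
  move=> c c'; apply/subr0_eq/rnorm_eq0/eqP; rewrite eq_le rnorm_ge0 andbT.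
  have := clB _ _ (cllin (-1) _ _ _ _ c' c).
  by rewrite !scaleN1r ![- _ + _]addrC subrr rnorm0.
have [T TP] := choice clex; exists T; split.
  split; first by split=> // a u v _ _; split=> //; apply: clU; first exact: TP;
    apply: cllin; exact: TP.
  by exists 1 => u; rewrite mul1r; apply: clB; exact: TP.
move=> x y r; apply: clU; first exact: TP.
by move=> e e0; exists x, y; rewrite !subrr !rnorm0 !ltW.
Qed.
End BoundedAdjoint.

(** * Resolvents of a maximal dissipative operator and of its adjoint *)

Section MaximalDissipative.
Variables (R : realType) (H : hilbertType R).

Lemma Im_ip_le (x y : H) : complex.Im '[x, y] <= rnorm x * rnorm y.
Proof.
apply: le_trans (normc_ip_le x y).
rewrite (le_trans (ler_norm _)) // -(@ler_pXn2r _ 2) ?nnegrE ?normc_ge0 //.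
by rewrite real_normK ?num_real // normc2 lerDr sqr_ge0.
Qed.

Lemma Im_ip_ge0_approx (x y : H) :
  (forall e : R, 0 < e -> exists x' y', [/\ 0 <= complex.Im '[x', y'],
     rnorm (x' - x) <= e & rnorm (y' - y) <= e]) ->
  0 <= complex.Im '[x, y].
Proof.
move=> h; apply/ler_addgt0Pr => e e0.
pose n := rnorm x + rnorm y + 1.
have n0 : 0 < n by rewrite ltr_wpDl // addr_ge0 // rnorm_ge0.
pose d := Num.min 1 (e / n).
have d0 : 0 < d by rewrite lt_min ltr01 divr_gt0.
have d1 : d <= 1 by rewrite ge_min lexx.
have dn : d * n <= e by rewrite -ler_pdivlMr // ge_min lexx orbT.
have [x' [y' [im xx yy]]] := h d d0.
have -> : complex.Im '[x, y] = complex.Im '[x', y']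
    + complex.Im '[x - x', y'] + complex.Im '[x, y - y'].
  by rewrite ipBl ipBr !ReImE; ring.
have h1 : complex.Im '[x' - x, y'] <= d * (rnorm y + d).
  apply: le_trans (Im_ip_le _ _) _; apply: ler_pM => //; rewrite ?rnorm_ge0 //.
  have := rnormD y (y' - y); rewrite addrC subrK; lra.
have h2 : complex.Im '[x, y' - y] <= rnorm x * d.
  by apply: le_trans (Im_ip_le _ _) _; rewrite ler_wpM2l // rnorm_ge0.
have -> : complex.Im '[x - x', y'] = - complex.Im '[x' - x, y'].
  by rewrite !ipBl !ReImE; ring.
have -> : complex.Im '[x, y - y'] = - complex.Im '[x, y' - y].
  by rewrite !ipBr !ReImE; ring.
rewrite /n in dn; have := rnorm_ge0 x; have := rnorm_ge0 y; nra.
Qed.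

Variable A : operator H.
Hypothesis A_maxdiss : maximal_dissipative A.

Let A_lin : linear_on (dom A) A := A_maxdiss.1.1.1.
Let A_dense : dense (dom A) := A_maxdiss.1.1.2.
Let A_diss : forall h, dom A h -> 0 <= complex.Im '[A h, h] := A_maxdiss.1.2.

(** Every use of maximality goes through this: if adding the pair (u, w) to the
    graph of A keeps it dissipative, then (u, w) is already in the graph. When u
    is outside D(A), the extension to D(A) + C u is an operator, and maximality
    excludes it. When u is in D(A), the vector w - A u may be added with any
    coefficient to values of A without losing dissipativity, so it is orthogonal
    to D(A). *)
Lemma maximal_dissipativeP u w :
  (forall v c, dom A v -> 0 <= complex.Im '[A v + c *: w, v + c *: u]) ->
  dom A u /\ A u = w.
Proof.
move=> h; have [[D0 A0] AD AB AZ] := linear_on_ind A_lin.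
have [Du|nDu] := pselect (dom A u).
  split=> //; apply/esym/subr0_eq/(dense_orth A_dense) => x Dx.
  rewrite ipC; set q := '[_, _].
  have hc c : 0 <= complex.Im '[A x, x] + complex.Im (c * q).
    have [Dcu Acu] := AZ c u Du; have [Dv Av] := AB x _ Dx Dcu.
    have := h _ c Dv; rewrite subrK Av Acu -addrA (addrC (- _)) -scalerBr.
    by rewrite ipDl ipZl ImD.
  have [->|q0] := eqVneq q 0; first by rewrite conjC0.
  have m0 : 0 < complex.Re q ^+ 2 + complex.Im q ^+ 2.
    rewrite -normc2 exprn_gt0 // lt_def normc_ge0 andbT; apply/eqP.
    by move/Normc.eq0_normc => /eqP; apply/negP.
  (* a coefficient that would make the imaginary part equal to -1 *)
  have := hc (- 'i * (((complex.Im '[A x, x] + 1) /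
     (complex.Re q ^+ 2 + complex.Im q ^+ 2))%:C)%C * Num.conj q).
  set t := _ / _; rewrite !ReImE /= => im.
  have : t * (complex.Re q ^+ 2 + complex.Im q ^+ 2) = complex.Im '[A x, x] + 1.
    by rewrite /t divfK // gt_eqF.
  move=> tE; suff : (1 : R) <= 0 by rewrite ler10.
  lra.
exfalso; apply: (nDu).
pose rel x y := exists v c, [/\ dom A v, x = v + c *: u & y = A v + c *: w].
have relU x y y' : rel x y -> rel x y' -> y = y'.
  move=> [v [c [Dv -> ->]]] [v' [c' [Dv' e ->]]].
  have [cc|cc] := eqVneq c c'; first by move: e; rewrite -cc => /addIr ->.
  case: (nDu); have [Dvv _] := AB _ _ Dv' Dv.
  have : v' - v = (c - c') *: u.
    by rewrite scalerBl; apply/eqP; rewrite subr_eq addrAC -subr_eq opprK -e addrC.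
  move=> vv; have [] := AZ (c - c')^-1 _ Dvv.
  by rewrite vv scalerA mulVf ?subr_eq0 // scale1r.
pose B := @Operator R H [set x | exists y, rel x y] (fun x => get [set y | rel x y]).
have BP x y : rel x y -> dom B x /\ B x = y.
  move=> r; split; first by exists y.
  by apply: (relU x) => //; apply: (@getI _ [set y | rel x y]) r.
have Brel x : dom B x -> rel x (B x).
  by move=> [y r]; have [_ ->] := BP _ _ r.
have ext : extends B A.
  split=> v Dv; have r : rel v (A v) by exists v, 0; rewrite !scale0r !addr0.
    by exists (A v).
  exact: (BP _ _ r).2.
have Bd : dissipative B.
  split; last first.
    by move=> x /Brel[v [c [Dv -> ->]]]; exact: h.
  split; last by move=> O O0 Oo; have [x [Ox Ax]] := A_dense O0 Oo;
    exists x; split=> //; exact: ext.1.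
  split; first by exact: ext.1 D0.
  move=> a x y /Brel[v [c [Dv xE ->]]] /Brel[v' [c' [Dv' yE ->]]].
  apply: BP; have [Da Aa] := A_lin.2 a v v' Dv Dv'.
  exists (a *: v + v'), (a * c + c'); split=> //.
    by rewrite xE yE scalerDr scalerA scalerDl addrACA.
  by rewrite Aa scalerDr scalerA scalerDl addrACA.
rewrite -(A_maxdiss.2 B Bd ext); exists w, 0, 1.
by rewrite !scale1r A0 !add0r.
Qed.

Lemma dissipative_lower z u : dom A u -> complex.Im z < 0 ->
  - complex.Im z * rnorm u <= rnorm (A u - z *: u).
Proof.
move=> Du z0; have [->|n0] := eqVneq (rnorm u) 0.
  by rewrite mulr0 rnorm_ge0.
have n1 : 0 < rnorm u by rewrite lt_def n0 rnorm_ge0.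
rewrite -(ler_pM2r n1); apply: le_trans (Im_ip_le _ _).
rewrite ipBl ipZl !ReImE Im_ipxx Re_ipxx.
by have := A_diss Du; lra.
Qed.

(** The range of A - z is dense: a vector y orthogonal to it satisfies
    <A v, y> = z <v, y>, so the pair (y, conj z y) keeps the graph dissipative,
    hence A y = conj z y and y = 0. It is closed, because A - z is bounded below
    and the limit of a convergent family in the graph of A again keeps the graph
    dissipative. *)
Lemma maximal_dissipative_surj z g : complex.Im z < 0 ->
  exists u, dom A u /\ A u - z *: u = g.
Proof.
move=> z0; have [[D0 A0] AD AB AZ] := linear_on_ind A_lin.
have Vs : subspace [set A u - z *: u | u in dom A].
  split; first by exists 0 => //; rewrite A0 scaler0 subr0.
  move=> a _ _ [u Du <-] [v Dv <-]; have [Dw Aw] := A_lin.2 a u v Du Dv.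
  exists (a *: u + v) => //; rewrite Aw scalerDr scalerA (mulrC z) -scalerA.
  by rewrite opprD addrACA scalerBr.
have Vo y : (forall x, [set A u - z *: u | u in dom A] x -> '[x, y] = 0) -> y = 0.
  move=> yo.
  have Ay v : dom A v -> '[A v, y] = z * '[v, y].
    by move=> Dv; apply/eqP; rewrite -subr_eq0 -ipZl -ipBl yo //; exists v.
  have [|Dy Ayy] := @maximal_dissipativeP y (Num.conj z *: y).
    move=> v c Dv; rewrite ipDl !ipDr !ipZl !ipZr Ay // (ipC y v).
    have := A_diss Dv; rewrite !ReImE Im_ipxx Re_ipxx => h.
    have : 0 <= - complex.Im z * ((complex.Re c ^+ 2 + complex.Im c ^+ 2) * rnorm y ^+ 2).
      by rewrite mulr_ge0 ?oppr_ge0 ?(ltW z0) // mulr_ge0 ?sqr_ge0 // addr_ge0 ?sqr_ge0.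
    lra.
  have := yo (A y - z *: y); rewrite Ayy ipBl !ipZl => /(_ _)/eqP h.
  apply: rnorm_eq0; apply/eqP; rewrite -sqrf_eq0.
  have : '[y, y] * (Num.conj z - z) = 0.
    by rewrite mulrC mulrBl; apply/eqP/h; exists y => //; rewrite Ayy.
  move/(congr1 (@complex.Im _)); rewrite !ReImE Im_ipxx Re_ipxx /= => h'.
  have : complex.Im z * rnorm y ^+ 2 = 0 by lra.
  by move/eqP; rewrite mulf_eq0 lt_eqF.
have approx := orth_dense Vs Vo g.
have zp : 0 < - complex.Im z by rewrite oppr_gt0.
have [|e d u v e0 d0 [Du Au] [Dv Av]|u uP] := @complete_approx R H
  (fun e u => dom A u /\ rnorm (A u - z *: u - g) <= e) (- complex.Im z)^-1.
- by move=> e e0; have [_ [u Du <-] ue] := approx e e0; exists u.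
- rewrite ler_pdivlMl //; have [Duv Auv] := AB _ _ Du Dv.
  apply: le_trans (dissipative_lower Duv z0) _.
  have -> : A (u - v) - z *: (u - v) = (A u - z *: u - g) - (A v - z *: v - g).
    by rewrite Auv; ip_ring.
  by apply: le_trans (rnormD _ _) _; rewrite rnormN lerD.
exists u.
have [|Du Au] := @maximal_dissipativeP u (g + z *: u); last first.
  by split=> //; rewrite Au addrK.
move=> v c Dv; apply: Im_ip_ge0_approx => e e0.
have n0 := normc_ge0 c; have k0 := normc_ge0 z.
set n := Normc.normc c in n0; set k := Normc.normc z in k0.
have m0 : 0 < (n + 1) * (k + 1) by rewrite mulr_gt0 // ltr_wpDl.
have e1 : 0 < e / ((n + 1) * (k + 1)) by rewrite divr_gt0.
have [d [x [d0 de [Dx Ax] xu]]] := uP _ e1.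
have [Dcx Acx] := AZ c x Dx; have [Dvx Avx] := AD _ _ Dv Dcx.
exists (A (v + c *: x)), (v + c *: x); split; first exact: A_diss.
  rewrite Avx Acx opprD addrACA subrr add0r -scalerBr rnormZ -/n.
  have -> : A x - (g + z *: u) = (A x - z *: x - g) + z *: (x - u).
    by ip_ring.
  have h1 : rnorm (A x - z *: x - g + z *: (x - u)) <= (k + 1) * (e / ((n + 1) * (k + 1))).
    apply: le_trans (rnormD _ _) _; rewrite rnormZ -/k mulrDl mul1r addrC.
    by rewrite lerD // ?ler_wpM2l // (le_trans Ax).
  apply: le_trans (ler_wpM2l n0 h1) _.
  have -> : n * ((k + 1) * (e / ((n + 1) * (k + 1)))) = n / (n + 1) * e.
    by field; lra.
  apply: ler_piMl; first exact: ltW.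
  by rewrite ler_pdivrMr ?ltr_wpDl // mul1r lerDl.
rewrite opprD addrACA subrr add0r -scalerBr rnormZ -/n.
apply: le_trans (ler_wpM2l n0 xu) _.
have -> : n * (e / ((n + 1) * (k + 1))) = n / ((n + 1) * (k + 1)) * e.
  by field; lra.
apply: ler_piMl; first exact: ltW.
rewrite ler_pdivrMr // mul1r; nra.
Qed.

Lemma resolventP z f : complex.Im z < 0 ->
  dom A (resolvent A z f) /\ A (resolvent A z f) - z *: resolvent A z f = f.
Proof.
move=> z0; have [u uP] := maximal_dissipative_surj f z0.
exact: (@getI _ [set u | dom A u /\ A u - z *: u = f] u uP).
Qed.

Lemma resolvent_uniq z u : complex.Im z < 0 -> dom A u ->
  resolvent A z (A u - z *: u) = u.
Proof.
move=> z0 Du; have [Dr Ar] := resolventP (A u - z *: u) z0.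
have [_ _ AB _] := linear_on_ind A_lin.
apply/subr0_eq/rnorm_eq0/eqP; rewrite eq_le rnorm_ge0 andbT.
have [Dd Ad] := AB _ _ Dr Du; have := dissipative_lower Dd z0.
set r := resolvent A z _ in Ad Ar *.
have -> : A (r - u) - z *: (r - u) = (A r - z *: r) - (A u - z *: u).
  by rewrite Ad; ip_ring.
by rewrite Ar subrr rnorm0 pmulr_rle0 // oppr_gt0.
Qed.

Lemma resolvent_norm z f : complex.Im z < 0 ->
  - complex.Im z * rnorm (resolvent A z f) <= rnorm f.
Proof.
move=> z0; have [Dr Ar] := resolventP f z0.
by have := dissipative_lower Dr z0; rewrite Ar.
Qed.

Lemma resolvent_lin z a f g : complex.Im z < 0 ->
  resolvent A z (a *: f + g) = a *: resolvent A z f + resolvent A z g.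
Proof.
move=> z0; have [Df Af] := resolventP f z0; have [Dg Ag] := resolventP g z0.
have [Dw Aw] := A_lin.2 a _ _ Df Dg.
rewrite -(resolvent_uniq z0 Dw) Aw; congr (resolvent A z).
by rewrite -{1}Af -{1}Ag; ip_ring.
Qed.

Local Notation As := (adjoint A).

Lemma adjointP u v : dom A u -> dom As v -> '[A u, v] = '[u, As v].
Proof.
move=> Du /(@getPex _ [set w | forall u, dom A u -> '[A u, v] = '[u, w]]).
exact.
Qed.

Lemma adjointI v w : (forall u, dom A u -> '[A u, v] = '[u, w]) ->
  dom As v /\ As v = w.
Proof.
move=> h; have Dv : dom As v by exists w.
split=> //; apply/subr0_eq/(dense_orth A_dense) => u Du.
by rewrite ipBr -(adjointP Du Dv) h // subrr.
Qed.

Lemma adjoint_lin : linear_on (dom As) As.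
Proof.
split; first by exists 0 => u _; rewrite !ip0r.
move=> a u v Du Dv; apply: adjointI => w Dw.
by rewrite !ipDr !ipZr !adjointP.
Qed.

(** The adjoint of the bounded inverse of A - conj z is the inverse of the
    adjoint minus z. *)
Lemma adjoint_surj z g : 0 < complex.Im z ->
  exists v, dom As v /\ As v - z *: v = g.
Proof.
move=> z0; have z1 : complex.Im (Num.conj z) < 0 by rewrite Im_conj oppr_lt0.
have rb : bounded_operator (resolvent A (Num.conj z)).
  split; first by split=> // a u v _ _; rewrite resolvent_lin.
  exists (complex.Im z)^-1 => u; rewrite ler_pdivlMl //.
  by rewrite -{1}[complex.Im z]opprK -Im_conj resolvent_norm.
set v := badjoint (resolvent A (Num.conj z)) g; exists v.
have [|Dv Av] := @adjointI v (g + z *: v); last by rewrite Av addrK.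
move=> u Du; have := badjointP rb (A u - Num.conj z *: u) g.
by rewrite resolvent_uniq // -/v ipDr ipZr => ->; rewrite ipBl ipZl subrK.
Qed.

(** Duality: write v = (A - conj z) u, so that |v|^2 = <u, (adjoint A - z) v>. *)
Lemma adjoint_lower z v : 0 < complex.Im z -> dom As v ->
  complex.Im z * rnorm v <= rnorm (As v - z *: v).
Proof.
move=> z0 Dv; have z1 : complex.Im (Num.conj z) < 0 by rewrite Im_conj oppr_lt0.
have [->|n0] := eqVneq (rnorm v) 0; first by rewrite mulr0 rnorm_ge0.
have n1 : 0 < rnorm v by rewrite lt_def n0 rnorm_ge0.
have [Du Au] := resolventP v z1; have := resolvent_norm v z1.
set u := resolvent A _ v in Du Au *; rewrite Im_conj opprK => uv.
rewrite -(ler_pM2r n1) -mulrA -expr2 -Re_ipxx -{1}Au ipBl ipZl adjointP // -ipZr -ipBr.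
rewrite [leRHS]mulrC; apply: le_trans (ler_wpM2r (rnorm_ge0 _) uv).
by rewrite -mulrA ler_pM2l // Re_ip_le.
Qed.

Lemma adjoint_resolventP z f : 0 < complex.Im z ->
  dom As (resolvent As z f) /\ As (resolvent As z f) - z *: resolvent As z f = f.
Proof.
move=> z0; have [u uP] := adjoint_surj f z0.
exact: (@getI _ [set u | dom As u /\ As u - z *: u = f] u uP).
Qed.

Lemma adjoint_resolvent_uniq z u : 0 < complex.Im z -> dom As u ->
  resolvent As z (As u - z *: u) = u.
Proof.
move=> z0 Du; have [Dr Ar] := adjoint_resolventP (As u - z *: u) z0.
have [_ _ AB _] := linear_on_ind adjoint_lin.
apply/subr0_eq/rnorm_eq0/eqP; rewrite eq_le rnorm_ge0 andbT.
have [Dd Ad] := AB _ _ Dr Du; have := adjoint_lower z0 Dd.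
set r := resolvent As z _ in Dr Ad Ar *.
have -> : As (r - u) - z *: (r - u) = (As r - z *: r) - (As u - z *: u).
  by rewrite Ad; ip_ring.
by rewrite Ar subrr rnorm0 pmulr_rle0.
Qed.

Lemma adjoint_resolvent_norm z f : 0 < complex.Im z ->
  complex.Im z * rnorm (resolvent As z f) <= rnorm f.
Proof.
move=> z0; have [Dr Ar] := adjoint_resolventP f z0.
by have := adjoint_lower z0 Dr; rewrite Ar.
Qed.

Lemma adjoint_resolvent_lin z a f g : 0 < complex.Im z ->
  resolvent As z (a *: f + g) = a *: resolvent As z f + resolvent As z g.
Proof.
move=> z0; have [Df Af] := adjoint_resolventP f z0.
have [Dg Ag] := adjoint_resolventP g z0.
have [Dw Aw] := adjoint_lin.2 a _ _ Df Dg.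
rewrite -(adjoint_resolvent_uniq z0 Dw) Aw; congr (resolvent As z).
by rewrite -{1}Af -{1}Ag; ip_ring.
Qed.

End MaximalDissipative.

(** * Boundary maps and the characteristic function *)

Lemma conjCNi (C : numClosedFieldType) : Num.conj (- 'i) = 'i :> C.
Proof. by rewrite (rmorphN Num.conj) /= conjCi opprK. Qed.

(** A resolvent is bounded into the domain with its graph norm. *)
Lemma boundary_resolvent_bounded (R : realType) (H K : hilbertType R)
    (B : operator H) (c : R[i]) (T : H -> K) (z : R[i]) (r : H -> H) (k : R) :
  boundary_map B c T -> 0 < k ->
  (forall f, dom B (r f) /\ B (r f) - z *: r f = f) ->
  (forall a f g, r (a *: f + g) = a *: r f + r g) ->
  (forall f, k * rnorm (r f) <= rnorm f) ->
  bounded_operator (fun f => T (r f)).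
Proof.
move=> [Tl [M TM] _ _] k0 rP rl rk; split.
  split=> // a u v _ _; split=> //; rewrite rl.
  by have [_ ->] := Tl.2 a (r u) (r v) (rP u).1 (rP v).1.
exists (`|M| * (k^-1 + (1 + Normc.normc z * k^-1))) => f.
have [Dr Br] := rP f; apply: le_trans (TM _ Dr) _.
apply: le_trans (ler_wpM2r (sqrtr_ge0 _) (ler_norm M)) _.
rewrite -mulrA ler_wpM2l //.
have rf : rnorm (r f) <= k^-1 * rnorm f by rewrite ler_pdivlMl.
have Brf : rnorm (B (r f)) <= (1 + Normc.normc z * k^-1) * rnorm f.
  have -> : B (r f) = f + z *: r f by rewrite -{2}Br; ip_ring.
  apply: le_trans (rnormD _ _) _; rewrite rnormZ mulrDl mul1r lerD2l -mulrA.
  by rewrite ler_wpM2l // normc_ge0.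
rewrite mulrDl; apply: le_trans (lerD rf Brf).
rewrite -[leRHS]ger0_norm ?addr_ge0 ?rnorm_ge0 // -sqrtr_sqr ler_wsqrtr //.
by have := mulr_ge0 (rnorm_ge0 (r f)) (rnorm_ge0 (B (r f))); nra.
Qed.

Section Boundary.
Variables (R : realType) (H E Es : hilbertType R).
Variables (A : operator H) (G : H -> E) (Gs : H -> Es).
Hypothesis A_maxdiss : maximal_dissipative A.
Hypothesis G_boundary : boundary_map A 'i G.
Hypothesis Gs_boundary : boundary_map (adjoint A) (- 'i) Gs.

Local Notation As := (adjoint A).
Local Notation S := (characteristic_function A G Gs).

Let G_lin : linear_on (dom A) G. Proof. by case: G_boundary. Qed.
Let Gs_lin : linear_on (dom As) Gs. Proof. by case: Gs_boundary. Qed.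
Let A_lin : linear_on (dom A) A := A_maxdiss.1.1.1.
Let As_lin := adjoint_lin A_maxdiss.

Lemma G_green u v : dom A u -> dom A v ->
  '[G u, G v] = - 'i * ('[A u, v] - '[u, A v]).
Proof.
move=> Du Dv; case: G_boundary => _ _ _ /(_ u v Du Dv) ->.
by ring: (sqrCi R[i]).
Qed.

Lemma Gs_green u v : dom As u -> dom As v ->
  '[Gs u, Gs v] = 'i * ('[As u, v] - '[u, As v]).
Proof.
move=> Du Dv; case: Gs_boundary => _ _ _ /(_ u v Du Dv) ->.
by ring: (sqrCi R[i]).
Qed.

(** The two Green formulas give
    |G u|^2 - |Gs w|^2 = 2 Im z |u - w|^2. *)
Lemma characteristic_contraction z u w : 0 < complex.Im z -> dom A u -> dom As w ->
  As w - z *: w = A u - z *: u ->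
  rnorm (Gs w) <= rnorm (G u).
Proof.
move=> z0 Du Dw AE.
rewrite -(@ler_pXn2r _ 2) ?nnegrE ?rnorm_ge0 // -!Re_ipxx.
rewrite G_green // Gs_green //.
have Au : A u = As w + z *: (u - w).
  by rewrite -[A u](subrK (z *: u)) -AE; ip_ring.
have h := adjointP Du Dw; move: h; rewrite (ipC u (A u)) (ipC w (As w)) Au.
rewrite !(ipBl, ipBr, ipDl, ipZl) => h.
have hr := congr1 (@complex.Re R) h; have hi := congr1 (@complex.Im R) h.
move: hr hi; rewrite (ipC u (As w)) (ipC u w) !ReImE !Im_ipxx !Re_ipxx.
have := sqr_ge0 (rnorm (u - w)); rewrite rnorm2B (ipC u w) !ReImE.
move=> sq hr hi.
have : 0 <= complex.Im z * (rnorm u ^+ 2 + rnorm w ^+ 2 - 2 * complex.Re '[w, u]).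
  by rewrite mulr_ge0 // ltW.
lra.
Qed.

(** The contraction bound makes the defining relation on the range of G extend
    to all of E. *)
Lemma characteristic_functionP z : 0 < complex.Im z ->
  bounded_operator (S z) /\
  forall u, dom A u -> S z (G u) = Gs (resolvent As z (A u - z *: u)).
Proof.
move=> z0; suff [T TP] : exists T : E -> Es, bounded_operator T /\
  forall u, dom A u -> T (G u) = Gs (resolvent As z (A u - z *: u)).
  exact: (@getI _ [set T : E -> Es | bounded_operator T /\
    forall u, dom A u -> T (G u) = Gs (resolvent As z (A u - z *: u))] T TP).
pose w u := resolvent As z (A u - z *: u).
have wP u : dom As (w u) /\ As (w u) - z *: w u = A u - z *: u.
  exact: adjoint_resolventP.
have [|x y [u [Du -> ->]]|x e e0|T [Tb TP]] := @extend_dense R E Es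
  (fun x y => exists u, [/\ dom A u, x = G u & y = Gs (w u)]).
- move=> a _ _ _ _ [u [Du -> ->]] [v [Dv -> ->]].
  have [Duv Guv] := G_lin.2 a u v Du Dv; have [_ Auv] := A_lin.2 a u v Du Dv.
  exists (a *: u + v); split=> //.
  have [_ <-] := Gs_lin.2 a _ _ (wP u).1 (wP v).1; congr (Gs _).
  by rewrite /w -adjoint_resolvent_lin // Auv; congr (resolvent _ _ _); ip_ring.
- have [Dw Aw] := wP u; exact: characteristic_contraction Aw.
- case: G_boundary => _ _ Gd _; have [_ [u Du <-] xu] := dense_approx Gd x e0.
  by exists (G u), (Gs (w u)); split; [exists u | exact: ltW].
- by exists T; split=> // u Du; apply: TP; exists u.
Qed.

Section RightParameter.
Variable l : R[i].
Hypothesis l_upper : 0 < complex.Im l.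

Let l1 : complex.Im (- l) < 0. Proof. by rewrite ImN oppr_lt0. Qed.
Let l2 : 0 < complex.Im (- Num.conj l). Proof. by rewrite ImN Im_conj opprK. Qed.

Lemma G_resolvent_bounded : bounded_operator (fun f => G (resolvent A (- l) f)).
Proof.
apply: (@boundary_resolvent_bounded _ _ _ _ _ _ (- l) _ (complex.Im l) G_boundary) => //.
- by move=> f; exact: resolventP.
- by move=> *; exact: resolvent_lin.
- by move=> f; have := resolvent_norm A_maxdiss f l1; rewrite ImN opprK.
Qed.

Lemma G_radj_bounded : bounded_operator (G_radj A G l).
Proof. exact: badjoint_bounded G_resolvent_bounded. Qed.

(** On the range of G the adjoint of G (A + l)^-1 can be computed: Green's formula
    for A moves G h to the other side, and the resolvent identity brings in the
    solution k of (adjoint A + conj l) k = (A + conj l) h. The same k gives the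
    value of the characteristic function. *)
Lemma G_radj_range h : dom A h ->
  exists k, [/\ dom As k, As k + Num.conj l *: k = A h + Num.conj l *: h,
    G_radj A G l (G h) = 'i *: (h - k) & S (- Num.conj l) (G h) = Gs k].
Proof.
move=> Dh; pose k := resolvent As (- Num.conj l) (A h - (- Num.conj l) *: h).
have [Dk Ak] := adjoint_resolventP A_maxdiss (A h - (- Num.conj l) *: h) l2.
rewrite -/k !scaleNr !opprK in Dk Ak.
exists k; split=> //; last exact: (characteristic_functionP l2).2.
apply: ip_eqP => f; rewrite -(badjointP G_resolvent_bounded).
have [Dr Ar] := resolventP A_maxdiss f l1; set r := resolvent A _ f in Dr Ar *.
rewrite G_green // ipZr ipBr -{1 2}Ar scaleNr opprK !ipDl !ipZl conjCi.
have -> : '[A r, k] + l * '[r, k] = '[r, As k + Num.conj l *: k].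
  by rewrite ipDr ipZr conjCK adjointP.
by rewrite Ak ipDr ipZr conjCK; ring.
Qed.

(** The condition on adjoint A together with (II), at a boundary value G h: with
    k as above, u + i (h - k) = i (h - i u - k), and k cancels out of (II). *)
Lemma star_right h u xm : dom A h ->
  (dom As (u + G_radj A G l (G h)) /\
   xm = S (- Num.conj l) (G h) - 'i *: Gs (u + G_radj A G l (G h))) <->
  (dom As (h - 'i *: u) /\ xm = Gs (h - 'i *: u)).
Proof.
move=> Dh; have [k [Dk Ak -> ->]] := G_radj_range Dh.
have [_ GsD GsB GsZ] := linear_on_ind Gs_lin.
set p := u + _; set q := h - _.
have pE : p = 'i *: (q - k).
  by rewrite /p /q; ip_ring_i R.
have qE : q = k - 'i *: p.
  by rewrite pE; ip_ring_i R.
split=> -[D ->].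
  have [Dip Gip] := GsZ 'i _ D; have [Dq Gq] := GsB _ _ Dk Dip.
  by rewrite qE Gq Gip.
have [Dqk Gqk] := GsB _ _ D Dk; have [Dp Gp] := GsZ 'i _ Dqk.
rewrite pE; split=> //; rewrite Gp Gqk.
ip_ring_i R.
Qed.

(** The parameter l disappears by the equation defining k. *)
Lemma calL_star h u : dom A h -> dom As (h - 'i *: u) ->
  As (u + G_radj A G l (G h)) + Num.conj l *: G_radj A G l (G h) =
  'i *: (As (h - 'i *: u) - A h).
Proof.
move=> Dh Dq; have [k [Dk Ak -> _]] := G_radj_range Dh.
have [_ AsD AsB AsZ] := linear_on_ind As_lin.
have -> : u + 'i *: (h - k) = 'i *: (h - 'i *: u - k).
  ip_ring_i R.
have [Dqk Aqk] := AsB _ _ Dq Dk; have [_ ->] := AsZ 'i _ Dqk.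
rewrite Aqk.
have -> : A h = As k + Num.conj l *: k - Num.conj l *: h by rewrite Ak addrK.
ip_ring.
Qed.
End RightParameter.

Section LeftParameter.
Variable m : R[i].
Hypothesis m_lower : complex.Im m < 0.

Let m1 : 0 < complex.Im (- m). Proof. by rewrite ImN oppr_gt0. Qed.
Let m2 : complex.Im (- Num.conj m) < 0. Proof. by rewrite ImN Im_conj opprK. Qed.

Lemma Gs_resolvent_bounded : bounded_operator (fun f => Gs (resolvent As (- m) f)).
Proof.
apply: (@boundary_resolvent_bounded _ _ _ _ _ _ (- m) _ (complex.Im (- m)) Gs_boundary) => //.
- by move=> f; exact: adjoint_resolventP.
- by move=> *; exact: adjoint_resolvent_lin.
- by move=> f; exact: adjoint_resolvent_norm.
Qed.

(** Mirror image of the computation for G. The value of the adjoint of the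
    characteristic function is tested against the range of G, which is dense. *)
Lemma Gs_radj_range hs : dom As hs ->
  exists k, [/\ dom A k, A k + Num.conj m *: k = As hs + Num.conj m *: hs,
    Gs_radj A Gs m (Gs hs) = - 'i *: (hs - k) & badjoint (S (- m)) (Gs hs) = G k].
Proof.
move=> Dhs; pose k := resolvent A (- Num.conj m) (As hs - (- Num.conj m) *: hs).
have [Dk Ak] := resolventP A_maxdiss (As hs - (- Num.conj m) *: hs) m2.
rewrite -/k !scaleNr !opprK in Dk Ak.
have BE : Gs_radj A Gs m (Gs hs) = - 'i *: (hs - k).
  apply: ip_eqP => f; rewrite -(badjointP Gs_resolvent_bounded).
  have [Dr Ar] := adjoint_resolventP A_maxdiss f m1.
  set r := resolvent As _ f in Dr Ar *.
  rewrite Gs_green // ipZr ipBr -{1 2}Ar scaleNr opprK !ipDl !ipZl conjCNi.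
  have -> : '[As r, k] + m * '[r, k] = '[r, A k + Num.conj m *: k].
    by rewrite ipDr ipZr conjCK; congr (_ + _); rewrite [LHS]ipC -adjointP // -ipC.
  by rewrite Ak ipDr ipZr conjCK; ring.
exists k; split=> //; apply/subr0_eq.
case: G_boundary => _ _ Gd _; apply: (dense_orth Gd) => _ [h Dh <-].
have [Sb SG] := characteristic_functionP m1.
rewrite ipBr -(badjointP Sb) SG // (badjointP Gs_resolvent_bounded).
rewrite -[badjoint _ (Gs hs)]/(Gs_radj A Gs m (Gs hs)) BE.
rewrite G_green // scaleNr opprK ipDl ipZl !ipZr !ipBr conjCNi.
have -> : '[A h, hs] = '[h, As hs] by rewrite adjointP.
have : '[h, A k + Num.conj m *: k] = '[h, As hs + Num.conj m *: hs] by rewrite Ak.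
rewrite !ipDr !ipZr conjCK => /eqP; rewrite addrC -subr_eq0 => /eqP e.
have -> : '[h, A k] = '[h, As hs] + m * '[h, hs] - m * '[h, k].
  by apply/eqP; rewrite -subr_eq0; apply/eqP; rewrite -[RHS]e; ring.
ring.
Qed.

(** The condition on A together with (I), at a boundary value Gs hs. *)
Lemma star_left hs u xp : dom As hs ->
  (dom A (u + Gs_radj A Gs m (Gs hs)) /\
   xp = badjoint (S (- m)) (Gs hs) + 'i *: G (u + Gs_radj A Gs m (Gs hs))) <->
  (dom A (hs + 'i *: u) /\ xp = G (hs + 'i *: u)).
Proof.
move=> Dh; have [k [Dk Ak -> ->]] := Gs_radj_range Dh.
have [_ GD GB GZ] := linear_on_ind G_lin.
set p := u + _; set q := hs + _.
have pE : p = - 'i *: (q - k).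
  by rewrite /p /q; ip_ring_i R.
have qE : q = k + 'i *: p.
  by rewrite pE; ip_ring_i R.
split=> -[D ->].
  have [Dip Gip] := GZ 'i _ D; have [Dq Gq] := GD _ _ Dk Dip.
  by rewrite qE Gq Gip.
have [Dqk Gqk] := GB _ _ D Dk; have [Dp Gp] := GZ (- 'i) _ Dqk.
rewrite pE; split=> //; rewrite Gp Gqk.
ip_ring_i R.
Qed.
End LeftParameter.
End Boundary.

(** * Strong measurability and square-integrability *)

Section StronglyMeasurable.
Variables (R : realType) (K : hilbertType R).
Let mu := @lebesgue_measure R.

Lemma cvg_rnormP (s : nat -> K) x :
  s @ \oo --> x <-> forall e : R, 0 < e -> exists N, forall n, (N <= n)%N ->
    rnorm (s n - x) <= e.
Proof.
split=> [/cvgrPdist_le h e e0|h].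
  have [|N _ hN] := h (e%:C)%C; first by rewrite ltcR.
  by exists N => n Nn; have := hN n Nn; rewrite /= norm_rnorm lecR rnormC.
apply/cvgrPdist_le => -[e e']; rewrite ltcE /= => /andP[/eqP -> e0].
have [N hN] := h e e0; exists N => // n Nn /=.
by rewrite norm_rnorm lecR rnormC hN.
Qed.

Lemma simple_function_comp2 (op : K -> K -> K) (s t : R -> K) :
  simple_function s -> simple_function t ->
  simple_function (fun x => op (s x) (t x)).
Proof.
move=> [fs ms] [ft mt]; split.
  apply: (sub_finite_set _ (finite_image2 op fs ft)) => _ [x _ <-].
  by exists (s x); [exists x | exists (t x) => //; exists x].
move=> y.
pose F (a : K) := \bigcup_(b in range t `&` [set b | op a b = y])
  (s @^-1` [set a] `&` t @^-1` [set b]).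
rewrite (_ : _ @^-1` _ = \bigcup_(a in range s) F a); last first.
  apply/seteqP; split=> x /=.
    move=> xy; exists (s x); first by exists x.
    by exists (t x) => //; split=> //; exists x.
  by move=> [a _ [b [_ /= <-] [/= <- <-]]].
apply: fin_bigcup_measurable => // a _; apply: fin_bigcup_measurable.
  by apply: sub_finite_set ft => ? [].
by move=> b _; apply: measurableI.
Qed.

Lemma simple_function_measurable (psi : K -> R) (s : R -> K) :
  simple_function s -> measurable_fun setT (psi \o s).
Proof.
move=> [fs ms] _ B mB; rewrite setTI.
rewrite (_ : _ @^-1` _ =
    \bigcup_(a in range s `&` psi @^-1` B) (s @^-1` [set a])).
  apply: fin_bigcup_measurable; last by move=> a _; exact: ms.
  by apply: sub_finite_set fs => ? [].
apply/seteqP; split=> x /=.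
  by move=> Bx; exists (s x) => //; split=> //; exists x.
by move=> [a [_ /= Ba] ->].
Qed.

(** Lipschitz functions are what is needed to pass from strong measurability to
    measurability of the norm and of the products with fixed vectors. *)
Definition lipschitz_fun (psi : K -> R) :=
  exists C : R, forall x y, `|psi x - psi y| <= C * rnorm (x - y).

Lemma strongly_measurable_comp (D : set R) (psi : K -> R) (f : R -> K) :
  lipschitz_fun psi -> strongly_measurable D f -> measurable_fun D (psi \o f).
Proof.
move=> [C pC] [s [ss sf]].
apply: (@measurable_fun_cvg _ _ _ _ (fun n => psi \o s n)) => [n|x Dx].
  exact: measurable_funS (simple_function_measurable psi (ss n)).
apply/cvgrPdist_le => e e0.
have C0 : 0 < `|C| + 1 by rewrite ltr_wpDl.
have [|N hN] := (cvg_rnormP _ _).1 (sf x Dx) (e / (`|C| + 1)).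
  by rewrite divr_gt0.
exists N => // n /= Nn; rewrite distrC; apply: le_trans (pC _ _) _.
have := hN n Nn; rewrite ler_pdivlMr // mulrC; apply: le_trans.
rewrite ler_wpM2r ?rnorm_ge0 // (le_trans (ler_norm C)) // lerDl.
exact: ler01.
Qed.

Lemma strongly_measurable_comp2 (D : set R) (a : R[i]) (f g : R -> K) :
  strongly_measurable D f -> strongly_measurable D g ->
  strongly_measurable D (fun x => a *: f x + g x).
Proof.
move=> [s [ss sf]] [t [st tg]].
exists (fun n x => a *: s n x + t n x); split.
  by move=> n; apply: (simple_function_comp2 (fun p q => a *: p + q)).
by move=> x Dx; apply: cvgD; [apply: cvgZr; exact: sf | exact: tg].
Qed.

Lemma rnorm_lipschitz : lipschitz_fun (@rnorm R K).
Proof.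
exists 1 => x y; rewrite mul1r ler_norml.
have tri (a b : K) : rnorm a <= rnorm b + rnorm (a - b).
  by rewrite -{1}(subrK b a) addrC rnormD.
by have := tri x y; have := tri y x; rewrite (rnormC y) => h1 h2; apply/andP;
  split; lra.
Qed.

Lemma Re_ip_lipschitz e : lipschitz_fun (fun x : K => complex.Re '[x, e]).
Proof.
exists (rnorm e) => x y; rewrite -ReB -ipBl mulrC ler_norml.
by rewrite Re_ip_le lerNl -ReN -ipNl opprB rnormC Re_ip_le.
Qed.

Lemma measurable_rnorm2 D (f : R -> K) : strongly_measurable D f ->
  measurable_fun D (EFin \o (fun x => rnorm (f x) ^+ 2)).
Proof.
move=> mf; apply/measurable_EFinP; apply: measurable_funX.
exact: strongly_measurable_comp rnorm_lipschitz mf.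
Qed.

Lemma measurable_Re_ip D (f : R -> K) e : strongly_measurable D f ->
  measurable_fun D (fun x => complex.Re '[f x, e]).
Proof. exact: (strongly_measurable_comp (Re_ip_lipschitz e)). Qed.

Lemma strongly_measurable_scale (D : set R) (phi : R -> R) (c : K) :
  measurable D -> measurable_fun D phi ->
  strongly_measurable D (fun x => (phi x)%:C%C *: c).
Proof.
move=> mD /measurable_EFinP/(approximation_sfun mD)[s sP].
exists (fun n x => (s n x)%:C%C *: c); split.
  move=> n; split.
    apply: (@sub_finite_set _ _ ((fun r : R => r%:C%C *: c) @` range (s n))).
      by move=> _ [x _ <-]; exists (s n x) => //; exists x.
    by apply: finite_image; exact: fimfunP.
  move=> y; rewrite (_ : _ @^-1` _ =
    \bigcup_(r in range (s n) `&` [set r : R | r%:C%C *: c = y]) (s n @^-1` [set r])).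
    by apply: fin_bigcup_measurable => //;
      apply: (@sub_finite_set _ _ (range (s n))) (fimfunP (s n)) => ? [].
  apply/seteqP; split=> x /=.
    by move=> xy; exists (s n x) => //; split=> //; exists x.
  by move=> [r [_ /= <-] ->].
move=> x Dx; apply/cvg_rnormP => e e0.
have c1 : 0 < rnorm c + 1 by rewrite ltr_wpDl // rnorm_ge0.
have /fine_cvgP[_] := sP x Dx.
move/cvgrPdist_le => /(_ (e / (rnorm c + 1))).
rewrite divr_gt0 // => /(_ isT)[N _ hN]; exists N => n Nn; have := hN n Nn.
rewrite /= -scalerBl -rmorphB rnormZ ler_pdivlMr // distrC; apply: le_trans.
rewrite /= expr0n addr0 sqrtr_sqr.
by rewrite ler_wpM2l // lerDl.
Qed.

(** |a f + g|^2 <= 2 |a|^2 |f|^2 + 2 |g|^2. *)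
Lemma L2_comb (D : set R) (a : R[i]) (f g : R -> K) : measurable D ->
  L2 D f -> L2 D g -> L2 D (fun x : R => a *: f x + g x : K).
Proof.
move=> mD [mf nf] [mg ng]; have mfg := strongly_measurable_comp2 a mf mg.
split=> //; rewrite /L2norm2 in nf ng *.
have m1 k (h : R -> K) : strongly_measurable D h ->
    measurable_fun D ((fun x => k%:E * (rnorm (h x) ^+ 2)%:E)%E : R -> \bar R).
  by move=> mh; apply: emeasurable_funM => //; exact: measurable_rnorm2.
have p0 (h : R -> K) k x : 0 <= k -> (0%R <= k%:E * (rnorm (h x) ^+ 2)%:E)%E.
  by move=> k0; rewrite -EFinM lee_fin mulr_ge0 // sqr_ge0.
have a0 : 0 <= 2 * Normc.normc a ^+ 2 by rewrite mulr_ge0 // sqr_ge0.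
apply: (@le_lt_trans _ _ (\int[mu]_(x in D)
   ((2 * Normc.normc a ^+ 2)%:E * (rnorm (f x) ^+ 2)%:E + 2%:E * (rnorm (g x) ^+ 2)%:E)))%E.
  apply: ge0_le_integral => //.
  - by move=> x _; rewrite lee_fin sqr_ge0.
  - exact: measurable_rnorm2.
  - by apply: emeasurable_funD; exact: m1.
  - move=> x _; rewrite -!EFinM -EFinD lee_fin.
    have := rnormD (a *: f x) (g x); rewrite rnormZ.
    have := rnorm_ge0 (a *: f x + g x); have := sqr_ge0 (Normc.normc a * rnorm (f x) - rnorm (g x)).
    nra.
rewrite ge0_integralD //; try by [exact: m1|move=> x _; exact: p0].
rewrite !ge0_integralZl //; try by [exact: measurable_rnorm2 | move=> x _; rewrite lee_fin sqr_ge0].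
by rewrite lte_add_pinfty // lte_mul_pinfty // ?lee_fin.
Qed.
End StronglyMeasurable.

(** * Half-lines and integrals over their intervals *)

Section Intervals.
Variable R : realType.
Let mu := @lebesgue_measure R.

Lemma ae_imply (P Q : R -> Prop) : (forall x, P x -> Q x) ->
  {ae mu, forall x, P x} -> {ae mu, forall x, Q x}.
Proof. by move=> PQ; apply: filterS => //; exact: (ae_filter_ringOfSetsType mu). Qed.

Lemma ae_and (P Q : R -> Prop) : {ae mu, forall x, P x} -> {ae mu, forall x, Q x} ->
  {ae mu, forall x, P x /\ Q x}.
Proof. exact: (@filterI _ _ (ae_filter_ringOfSetsType mu)). Qed.

(** By the differentiation theorem, h is almost everywhere the derivative of its
    vanishing primitive. *)
Lemma integral_eq0_ae (a b : R) (h : R -> R) :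
  mu.-integrable `]a, b[ (EFin \o h) ->
  (forall x, a < x < b -> (\int[mu]_(y in `]a, x[) h y)%R = 0) ->
  {ae mu, forall x, `]a, b[%classic x -> h x = 0}.
Proof.
move=> ih h0; pose f := h \_ `]a, b[.
have ifT : mu.-integrable setT (EFin \o f).
  by rewrite /f -restrict_EFin; apply/(integrable_restrict mu _ measurableT) => //; rewrite setTI.
have lf : locally_integrable setT f by apply: integrable_locally.
have iy y : mu.-integrable [set` Interval (BRight a) (BRight y)] (EFin \o f).
  by apply: integrableS ifT.
have := FTC1 iy lf; rewrite /=; apply: ae_imply => x /[swap].
rewrite /= in_itv /= => /andP[ax xb] /(_ ax)[dF].
rewrite /f patchE mem_set /=; last by rewrite in_itv /= ax xb.
move=> <-; rewrite derive1E.
have -> : 'D_1 (fun x0 : R => \int[mu]_(t in [set` Interval (BRight a) (BRight x0)]) f t) x =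
  'D_1 (cst 0 : R -> R) x.
  apply: near_eq_derive.
  have : \forall y \near x, y \in `]a, b[ by apply: near_in_itvoo; rewrite in_itv /= ax.
  apply: filterS => y; rewrite in_itv /= => /andP[ay yb].
  rewrite -Rintegral_itv_bndo_bndc; last by apply: integrableS ifT.
  rewrite -[RHS](h0 y); last by rewrite ay.
  apply: eq_Rintegral => z; rewrite inE /= in_itv /= => /andP[az zy].
  by rewrite /f patchE mem_set //= in_itv /= az (lt_trans zy).
exact: derive_cst.
Qed.

Lemma ae_itv_ex (a b : R) (P : R -> Prop) : a < b ->
  {ae mu, forall x, `]a, b[%classic x -> P x} -> exists2 x, a < x < b & P x.
Proof.
move=> ab aeP; apply: contrapT => /forall2NP nP.
have : mu `]a, b[%classic = 0%E.
  apply/(measure_negligible (mu := mu)) => //; move: aeP; apply: negligibleS => x /= xab.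
  by move/(_ xab) => Px; have [|//] := nP x; move: xab; rewrite in_itv.
rewrite /mu lebesgue_measure_itv /= lte_fin ab -EFinB => -[] /eqP.
by rewrite subr_eq0 gt_eqF.
Qed.

Definition halfline (D : set R) := D = Rneg \/ D = Rpos.

Lemma closure_Rneg s : closure Rneg s <-> s <= 0 :> R.
Proof.
split=> [|s0].
  have : closure (Rneg : set R) `<=` `]-oo, 0].
    rewrite [X in _ `<=` X]((closure_id _).1 (@lray_closed _ R 0)).
    by apply: closure_subset => x; rewrite /Rneg /= !in_itv /= => /ltW.
  by move=> h /h; rewrite /= in_itv.
move=> B /nbhs_ballP[e /= e0 Be]; exists (s - e / 2); split.
  by rewrite /Rneg /= in_itv /= ltrBlDr ltr_wpDl // ?divr_gt0 // (le_lt_trans s0) // divr_gt0.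
apply: Be; rewrite /ball /= opprB addrC subrK ger0_norm; last by rewrite ltW // divr_gt0.
by rewrite ltr_pdivrMr // ltr_pMr // ltr1n.
Qed.

Lemma closure_Rpos s : closure Rpos s <-> 0 <= s :> R.
Proof.
split=> [|s0].
  have : closure (Rpos : set R) `<=` `[0, +oo[.
    rewrite [X in _ `<=` X]((closure_id _).1 (@rray_closed _ R 0)).
    by apply: closure_subset => x; rewrite /Rpos /= !in_itv /= !andbT => /ltW.
  by move=> h /h; rewrite /= in_itv /= andbT.
move=> B /nbhs_ballP[e /= e0 Be]; exists (s + e / 2); split.
  by rewrite /Rpos /= in_itv /= andbT ltr_wpDl // divr_gt0.
apply: Be; rewrite /ball /= opprD addrA subrr add0r normrN ger0_norm;
  last by rewrite ltW // divr_gt0.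
by rewrite ltr_pdivrMr // ltr_pMr // ltr1n.
Qed.

Lemma halfline_measurable D : halfline D -> measurable D.
Proof. by move=> [] ->; exact: measurable_itv. Qed.

Lemma halfline_closure0 D : halfline D -> closure D 0.
Proof. by move=> [] ->; [apply/closure_Rneg | apply/closure_Rpos]. Qed.

Lemma halfline_sub D s t : halfline D -> closure D s -> closure D t ->
  `]s, t[ `<=` D.
Proof.
move=> [] -> /=.
  move=> _ /closure_Rneg t0 x; rewrite /Rneg /= !in_itv /= => /andP[_ xt].
  exact: lt_le_trans xt t0.
move=> /closure_Rpos s0 _ x; rewrite /Rpos /= !in_itv /= andbT => /andP[sx _].
exact: le_lt_trans s0 sx.
Qed.

(** One-sided intervals at s, so that they stay inside the half-line also when s
    is its end point. *)
Lemma halfline_near D s (e : R) : halfline D -> closure D s -> 0 < e ->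
  exists a b, [/\ a < b, closure D a, closure D b &
    forall x, a < x < b -> `|x - s| <= e].
Proof.
move=> [] -> /=.
  move/closure_Rneg => s0 e0; exists (s - e), s; split.
  - by rewrite ltrBlDr ltrDl.
  - by apply/closure_Rneg; lra.
  - exact/closure_Rneg.
  - by move=> x /andP[h1 h2]; rewrite ler_norml; apply/andP; split; lra.
move/closure_Rpos => s0 e0; exists s, (s + e); split.
- by rewrite ltrDl.
- exact/closure_Rpos.
- by apply/closure_Rpos; lra.
- by move=> x /andP[h1 h2]; rewrite ler_norml; apply/andP; split; lra.
Qed.

Lemma halfline_exhaust D : halfline D -> exists a b : nat -> R,
  (forall n, [/\ a n < b n, closure D (a n) & closure D (b n)]) /\
  forall x, D x -> exists n, a n < x < b n.
Proof.
move=> [] ->.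
  exists (fun n => - n.+1%:R), (fun=> 0); split.
    move=> n; split; first by rewrite oppr_lt0.
      by apply/closure_Rneg; rewrite oppr_le0.
    exact/closure_Rneg.
  move=> x; rewrite /Rneg /= in_itv /= => x0; exists (Num.trunc `|x|).
  by rewrite x0 andbT ltrNl -(ltr0_norm x0) truncnS_gt.
exists (fun=> 0), (fun n => n.+1%:R); split.
  by move=> n; split; [exact: ltr0Sn | exact/closure_Rpos | exact/closure_Rpos].
move=> x; rewrite /Rpos /= in_itv /= andbT => x0; exists (Num.trunc `|x|).
by rewrite x0 -{1}(gtr0_norm x0) truncnS_gt.
Qed.

End Intervals.

(** * Traces and derivatives on a half-line *)

Lemma integrable_scale d (T : measurableType d) (R : realType)
    (nu : {measure set T -> \bar R}) (D : set T) (f : T -> R) (a : R) :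
  measurable D -> nu.-integrable D (EFin \o f) ->
  nu.-integrable D (EFin \o (fun x => a * f x)).
Proof.
by move=> mD /(integrableZl mD a); apply: eq_integrable.
Qed.

Section Sobolev.
Variables (R : realType) (K : hilbertType R).
Let mu := @lebesgue_measure R.
Variable D : set R.
Hypothesis hD : halfline D.

Let mD : measurable D. Proof. exact: halfline_measurable. Qed.

(** Real parts suffice: the imaginary part is the real part of the product with
    'i *: e. *)
Lemma primitiveP (w g : R -> K) :
  primitive D w g <->
  forall s t, closure D s -> closure D t -> s <= t -> forall e,
    complex.Re '[w t - w s, e] = (\int[mu]_(x in `]s, t[) complex.Re '[g x, e])%R.
Proof.
split=> h s t Ds Dt st e; first by rewrite (h s t Ds Dt st).
have ImE (x : K) : complex.Im '[x, e] = complex.Re '[x, 'i *: e].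
  by rewrite ipZr conjCi !ReImE; ring.
apply: eq_ReIm; rewrite /Cintegral /=; first exact: h.
by rewrite ImE h //; apply: eq_Rintegral => x _; rewrite -ImE.
Qed.

(** Young's inequality with a free weight d: choosing d small and then the
    interval short makes primitives continuous. *)
Lemma L2_itv_bound (g : R -> K) s t e (d : R) : L2 D g -> closure D s -> closure D t ->
  s <= t -> 0 < d ->
  (\int[mu]_(x in `]s, t[) `|(complex.Re '[g x, e])%:E| <=
   (d * fine (L2norm2 D g) + rnorm e ^+ 2 / d * (t - s))%:E)%E.
Proof.
move=> [mg ng] Ds Dt st d0.
have sub := halfline_sub hD Ds Dt.
have mI : measurable (`]s, t[%classic : set R) by exact: measurable_itv.
have m1 : measurable_fun `]s, t[ (EFin \o (fun x => rnorm (g x) ^+ 2)).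
  exact: measurable_funS mD sub (measurable_rnorm2 mg).
have p1 (x : R) : (0%R <= (rnorm (g x) ^+ 2)%:E)%E by rewrite lee_fin sqr_ge0.
have e1 : 0 <= rnorm e ^+ 2 / d by rewrite divr_ge0 ?sqr_ge0 // ltW.
apply: (@le_trans _ _ (\int[mu]_(x in `]s, t[)
   (d%:E * (rnorm (g x) ^+ 2)%:E + (rnorm e ^+ 2 / d)%:E)))%E.
  apply: ge0_le_integral => //.
  - apply: measurableT_comp => //; apply/measurable_EFinP.
    exact: measurable_funS mD sub (measurable_Re_ip e mg).
  - by apply: emeasurable_funD => //; apply: emeasurable_funM.
  - move=> x _; rewrite abse_EFin -EFinM -EFinD lee_fin.
    have : `|complex.Re '[g x, e]| <= rnorm (g x) * rnorm e.
      by rewrite ler_norml Re_ip_le lerNl -ReN -ipNl -[rnorm (g x)]rnormN Re_ip_le.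
    move/le_trans; apply; rewrite -(ler_pM2l d0).
    have -> : d * (d * rnorm (g x) ^+ 2 + rnorm e ^+ 2 / d) =
      (d * rnorm (g x)) ^+ 2 + rnorm e ^+ 2 by field; rewrite gt_eqF.
    have := sqr_ge0 (d * rnorm (g x) - rnorm e).
    have : 0 <= d * rnorm (g x) * rnorm e.
      by rewrite !mulr_ge0 ?rnorm_ge0 // ltW.
    nra.
rewrite ge0_integralD //; last 2 first.
- by move=> x _; rewrite mule_ge0 // lee_fin ltW.
- by apply: emeasurable_funM.
rewrite ge0_integralZl //; last by rewrite lee_fin ltW.
have mst : mu `]s, t[%classic = (t - s)%:E.
  rewrite /mu lebesgue_measure_itv /= lte_fin.
  by case: ltgtP st => // -> _; rewrite subrr.
rewrite integral_cst // [X in (_ + _ * X <= _)%E]mst.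
rewrite -EFinM EFinD; apply: leeD2r; rewrite EFinM.
apply: lee_wpmul2l; first by rewrite lee_fin ltW.
rewrite fineK; last by rewrite ge0_fin_numE // integral_ge0.
by apply: ge0_subset_integral => //; exact: measurable_rnorm2.
Qed.

Lemma L2_itv_integrable (g : R -> K) s t e : L2 D g -> closure D s -> closure D t ->
  s <= t ->
  mu.-integrable `]s, t[ (EFin \o (fun x => complex.Re '[g x, e])).
Proof.
move=> Lg Ds Dt st; apply/integrableP; split.
  apply/measurable_EFinP.
  exact: measurable_funS mD (halfline_sub hD Ds Dt) (measurable_Re_ip e Lg.1).
by apply: le_lt_trans (L2_itv_bound e Lg Ds Dt st ltr01) _; rewrite ltry.
Qed.

Lemma primitive_small (w g : R -> K) s t e (d : R) : L2 D g -> primitive D w g ->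
  closure D s -> closure D t -> 0 < d ->
  `|complex.Re '[w t - w s, e]| <=
    d * fine (L2norm2 D g) + rnorm e ^+ 2 / d * `|t - s|.
Proof.
move=> Lg /primitiveP pg Ds Dt d0.
wlog st : s t Ds Dt / s <= t.
  move=> h; case: (leP s t) => [|/ltW] st; first exact: h.
  by rewrite -normrN -ReN -ipNl opprB distrC; exact: h.
rewrite pg //; have ig := L2_itv_integrable e Lg Ds Dt st.
apply: le_trans (le_normr_Rintegral _ ig) _ => //.
rewrite ger0_norm ?subr_ge0 //.
have fine_le (I : \bar R) r : (0 <= I)%E -> (I <= r%:E)%E -> fine I <= r.
  by case: I => //= q _; rewrite lee_fin.
apply: fine_le; last exact: L2_itv_bound.
exact: integral_ge0.
Qed.

Lemma H1_derivative_comb (a : R) (f w g f' w' g' : R -> K) :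
  H1_derivative D f w g -> H1_derivative D f' w' g' ->
  H1_derivative D (fun x => a%:C%C *: f x + f' x)
    (fun x => a%:C%C *: w x + w' x) (fun x => a%:C%C *: g x + g' x).
Proof.
move=> [Lg fw /primitiveP pg] [Lg' fw' /primitiveP pg'].
split; first exact: L2_comb.
  by apply: (ae_imply _ (ae_and fw fw')) => x [h h'] Dx; rewrite h // h'.
apply/primitiveP => s t Ds Dt st e.
have ReE (x y : K) : complex.Re '[a%:C%C *: x + y, e] =
    a * complex.Re '[x, e] + complex.Re '[y, e].
  by rewrite ipDl ipZl !ReImE /=; ring.
under eq_Rintegral do rewrite ReE.
rewrite opprD addrACA -scalerBr ReE pg // pg' //.
have i1 := L2_itv_integrable e Lg Ds Dt st.
have i2 := L2_itv_integrable e Lg' Ds Dt st.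
have mI : measurable (`]s, t[%classic : set R) by exact: measurable_itv.
rewrite RintegralD // ?RintegralZl //.
exact: integrable_scale i1.
Qed.

(** A primitive that vanishes almost everywhere vanishes by continuity. Then all
    integrals of <g, e> over intervals vanish, so for each e the product <g, e>
    vanishes almost everywhere. The exceptional set depends on e, but only the
    countably many values y of simple functions tending to g are needed: at a
    point where all <g x, y> vanish, <g x, g x> = 0. *)
Lemma primitive_eq0 (w g : R -> K) : L2 D g ->
  {ae mu, forall x, D x -> w x = 0} -> primitive D w g ->
  (forall x, closure D x -> w x = 0) /\ {ae mu, forall x, D x -> g x = 0}.
Proof.
move=> Lg w0 pg.
have wcl x : closure D x -> w x = 0.
  move=> Dx; apply/rnorm_eq0/eqP; rewrite -sqrf_eq0 -Re_ipxx -normr_eq0 eq_le normr_ge0 andbT.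
  set e := w x; apply/ler_addgt0Pr => r r0; rewrite add0r.
  set N := fine (L2norm2 D g).
  have N0 : 0 <= N by apply: fine_ge0; apply: integral_ge0 => y _; rewrite lee_fin sqr_ge0.
  have E0 : 0 <= rnorm e ^+ 2 := sqr_ge0 _.
  pose d := r / 2 / (N + 1).
  have d0 : 0 < d by rewrite !divr_gt0 // ltr_wpDl.
  pose h := r / 2 * d / (rnorm e ^+ 2 + 1).
  have h0 : 0 < h by rewrite divr_gt0 ?ltr_wpDl // mulr_gt0 // divr_gt0.
  have [a [b [ab Da Db abx]]] := halfline_near hD Dx h0.
  have sub := halfline_sub hD Da Db.
  have [|t tab wt] := @ae_itv_ex R a b (fun t => w t = 0) ab.
    by apply: ae_imply w0 => y + yab; apply; exact: sub.
  have Dt : closure D t by apply/subset_closure/sub; rewrite /= in_itv.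
  have := primitive_small e Lg pg Dx Dt d0.
  rewrite wt sub0r -/e ipNl ReN normrN => /le_trans; apply.
  have r2 : 0 <= r / 2 by rewrite ltW // divr_gt0.
  have hd : d * N <= r / 2.
    by rewrite /d mulrAC ler_pdivrMr ?ltr_wpDl // ler_wpM2l // lerDl ler01.
  have hh : rnorm e ^+ 2 / d * `|t - x| <= r / 2.
    apply: (@le_trans _ _ (rnorm e ^+ 2 / d * h)).
      by rewrite ler_wpM2l ?abx // divr_ge0 // ltW.
    have -> : rnorm e ^+ 2 / d * h = rnorm e ^+ 2 * (r / 2) / (rnorm e ^+ 2 + 1).
      by rewrite /h; field; lra.
    by rewrite ler_pdivrMr ?ltr_wpDl // mulrC ler_wpM2l // lerDl ler01.
  by rewrite -/N; lra.
split=> //.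
have int0 e s t : closure D s -> closure D t -> s <= t ->
    (\int[mu]_(x in `]s, t[) complex.Re '[g x, e])%R = 0.
  move=> Ds Dt st; rewrite -((primitiveP w g).1 pg s t Ds Dt st).
  by rewrite !wcl // subrr ip0l.
have ae_e e : {ae mu, forall x, D x -> complex.Re '[g x, e] = 0}.
  have [a [b [abn abD]]] := halfline_exhaust hD.
  have : {ae mu, forall x, forall n, `]a n, b n[%classic x -> complex.Re '[g x, e] = 0}.
    apply: ae_foralln => n; have [ab Da Db] := abn n.
    apply: integral_eq0_ae; first exact: L2_itv_integrable (ltW ab).
    move=> x xab; apply: int0 => //; last by case/andP: xab => /ltW.
    by apply/subset_closure/(halfline_sub hD Da Db); rewrite /= in_itv.
  by apply: ae_imply => x h Dx; have [n xn] := abD x Dx; apply: (h n); rewrite /= in_itv.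
have [s [ss sg]] := Lg.1.
have ae_n : {ae mu, forall x, forall n, forall y, range (s n) y -> D x -> complex.Re '[g x, y] = 0}.
  apply: ae_foralln => n; have [/finite_seqP[q ->] _] := ss n.
  elim: q => [|y q IH]; first by apply: ae_imply (ae_e 0) => x _ y.
  apply: ae_imply (ae_and (ae_e y) IH) => x [h1 h2] z /=.
  by rewrite inE => /orP[/eqP ->|zq] //; apply: h2.
apply: ae_imply ae_n => x h Dx; apply/rnorm_eq0/eqP; rewrite -sqrf_eq0 eq_le sqr_ge0 andbT.
apply/ler_addgt0Pr => r r0; rewrite add0r.
have n1 : 0 < rnorm (g x) + 1 by rewrite ltr_wpDl // rnorm_ge0.
have [|n hn] := (cvg_rnormP _ _).1 (sg x Dx) (r / (rnorm (g x) + 1)).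
  by rewrite divr_gt0.
have := hn n (leqnn n) => {}hn.
have -> : rnorm (g x) ^+ 2 = complex.Re '[g x, g x - s n x].
  by rewrite ipBr ReB Re_ipxx (h n) ?subr0 //; exists x.
apply: le_trans (Re_ip_le _ _) _; rewrite rnormC.
move: hn; rewrite ler_pdivlMr // mulrC; apply: le_trans.
by rewrite ler_wpM2r ?rnorm_ge0 // lerDl.
Qed.

Lemma H1_derivative_uniq (f w g w' g' : R -> K) :
  H1_derivative D f w g -> H1_derivative D f w' g' ->
  (forall x, closure D x -> w x = w' x) /\ {ae mu, forall x, D x -> g x = g' x}.
Proof.
move=> h h'; have [Lg fw pg] := H1_derivative_comb (-1) h' h.
have aux (x y : K) : (-1)%:C%C *: y + x = x - y.
  by rewrite rmorphN rmorph1 scaleN1r addrC.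
have [|w0 g0] := primitive_eq0 Lg _ pg.
  by apply: ae_imply fw => x hx Dx; rewrite -hx // aux subrr.
split=> [x /w0|]; first by rewrite aux => /subr0_eq.
by apply: ae_imply g0 => x hx Dx; apply: subr0_eq; rewrite -aux hx.
Qed.

Lemma trace0E (f w g : R -> K) : H1_derivative D f w g -> trace0 D f = w 0.
Proof.
move=> h; have : exists x w' g', H1_derivative D f w' g' /\ w' 0 = x by exists (w 0), w, g.
move/(@getPex _ [set x | exists w g, H1_derivative D f w g /\ w 0 = x]).
move=> [w' [g' [h' e]]]; rewrite (_ : trace0 D f = w' 0); last exact: esym e.
by have [-> //] := H1_derivative_uniq h h'; exact: halfline_closure0.
Qed.

Lemma derivE (f w g : R -> K) : H1_derivative D f w g ->
  L2 D (deriv D f) /\ {ae mu, forall x, D x -> deriv D f x = g x}.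
Proof.
move=> h; have : exists g' w', H1_derivative D f w' g' by exists g, w.
move/(@getPex _ [set g | exists w, H1_derivative D f w g]) => [w' h'].
have [_ gg] := H1_derivative_uniq h' h.
by case: (h').
Qed.
End Sobolev.

(** * Moving the trace *)

Section Clamp.
Variable R : realType.
Let mu := @lebesgue_measure R.

Definition clamp (a b t : R) := Num.min b (Num.max a t).

Lemma clamp_measurable (a b : R) (D : set R) : measurable_fun D (clamp a b).
Proof.
by apply: measurable_minr => //; apply: measurable_maxr.
Qed.

Lemma integral_clamp (a b s t : R) : a <= b -> s <= t ->
  (\int[mu]_(x in `]s, t[) \1_`]a, b[ x)%R = clamp a b t - clamp a b s.
Proof.
move=> ab st; rewrite /Rintegral integral_indic //=.
have -> : `]a, b[ `&` `]s, t[ = `]Num.max a s, Num.min b t[%classic :> set R.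
  apply/seteqP; split=> x /=; rewrite !in_itv /= gt_max lt_min.
    by move=> [/andP[-> ->] /andP[-> ->]].
  by move=> /andP[/andP[-> ->] /andP[-> ->]].
rewrite /mu lebesgue_measure_itv /= lte_fin /clamp.
rewrite [X in fine X](_ : _ = (Num.max 0 (Num.min b t - Num.max a s))%:E) /=.
  rewrite !(minEle, maxEle).
  by case: (leP a s); case: (leP a t); case: (leP b t) => h3 h2 h1;
    repeat case: leP => ?; lra.
rewrite [Num.max 0 _]maxEle subr_ge0; case: ltP => h; first by rewrite ltW.
case: leP => // h'; rewrite (_ : Num.min b t = Num.max a s) ?subrr //.
by apply/le_anti; rewrite h h'.
Qed.

Definition bump (a b q p t : R) := p + q * clamp a b t.

(** A piecewise linear function that is 1 at 0 and 0 beyond distance 1, as an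
    affine function of a clamp. *)
Lemma halfline_bump (D : set R) : halfline D -> exists a b q p : R,
  [/\ b - a = 1, `|q| = 1, `]a, b[ `<=` D, bump a b q p 0 = 1 &
    forall x, D x -> `|bump a b q p x| <= \1_`]a, b[ x].
Proof.
move=> [] ->.
  exists (-1), 0, 1, 1; split.
  - by rewrite opprK add0r.
  - by rewrite normr1.
  - by move=> x; rewrite /Rneg /= !in_itv /= => /andP[].
  - by rewrite /bump /clamp max_r ?minxx; lra.
  - move=> x; rewrite /Rneg /= in_itv /= => x0; rewrite indicE.
    rewrite /bump /clamp; case: (ltP (-1) x) => h.
      rewrite mem_set /=; last by rewrite in_itv /= h.
      rewrite min_r; last exact: ltW.
      by rewrite ler_norml; apply/andP; split; lra.
    rewrite min_r; last by lra.
    by rewrite mul1r subrr normr0 ler0n.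
exists 0, 1, (-1), 1; split.
- by rewrite subr0.
- by rewrite normrN1.
- by move=> x; rewrite /Rpos /= !in_itv /= andbT => /andP[].
- by rewrite /bump /clamp maxxx min_r ?ler01 // mulr0 addr0.
- move=> x; rewrite /Rpos /= in_itv /= andbT => x0; rewrite indicE.
  rewrite /bump /clamp max_r ?(ltW x0) //; case: (ltP x 1) => h.
    rewrite mem_set /=; last by rewrite in_itv /= x0.
    by rewrite ler_norml; apply/andP; split; lra.
  by rewrite mulN1r subrr normr0 ler0n.
Qed.
End Clamp.

Section Shift.
Variables (R : realType) (K : hilbertType R).
Let mu := @lebesgue_measure R.
Variable D : set R.
Hypothesis hD : halfline D.
Let mD : measurable D. Proof. exact: halfline_measurable. Qed.

Lemma L2norm2_scale_le (phi : R -> R) (c : K) (a b : R) : b - a = 1 ->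
  `]a, b[ `<=` D -> measurable_fun D phi ->
  (forall x, D x -> `|phi x| <= \1_`]a, b[ x) ->
  L2 D (fun x => (phi x)%:C%C *: c) /\
  (L2norm2 D (fun x => (phi x)%:C%C *: c) <= (rnorm c ^+ 2)%:E)%E.
Proof.
move=> ba sub mphi phi1; have mf := strongly_measurable_scale c mD mphi.
suff le : (L2norm2 D (fun x => (phi x)%:C%C *: c) <= (rnorm c ^+ 2)%:E)%E.
  by split=> //; split=> //; apply: le_lt_trans le _; rewrite ltry.
have mI : measurable (`]a, b[%classic : set R) by exact: measurable_itv.
have mab : mu `]a, b[%classic = 1%E.
  by rewrite /mu lebesgue_measure_itv /= lte_fin -subr_gt0 ba ltr01 -EFinB ba.
have m1 : measurable_fun D (EFin \o (\1_`]a, b[ : R -> R)).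
  by apply/measurable_EFinP; exact: measurable_indic.
apply: (@le_trans _ _ (\int[mu]_(x in D) ((rnorm c ^+ 2)%:E * (\1_`]a, b[ x)%:E)))%E.
  apply: ge0_le_integral => //.
  - by move=> x _; rewrite lee_fin sqr_ge0.
  - exact: measurable_rnorm2.
  - by apply: emeasurable_funM.
  - move=> x Dx; rewrite -EFinM lee_fin rnormZ exprMn mulrC.
    rewrite ler_wpM2l ?sqr_ge0 //= expr0n addr0 sqrtr_sqr.
    apply: le_trans (phi1 x Dx); rewrite expr2 ler_piMl //.
    by apply: le_trans (phi1 x Dx) _; rewrite indicE lern1 leq_b1.
rewrite ge0_integralZl //; last by rewrite lee_fin sqr_ge0.
rewrite integral_indic // (_ : _ `&` _ = `]a, b[%classic); last exact/setIidl.
by rewrite [X in (_ * X)%E]mab mule1.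
Qed.

Lemma H1_bump (c : K) : exists w g : R -> K,
  [/\ L2 D w, H1_derivative D w w g, w 0 = c,
    (L2norm2 D w <= (rnorm c ^+ 2)%:E)%E &
    (L2norm2 D g <= (rnorm c ^+ 2)%:E)%E].
Proof.
have [a [b [q [p [ba q1 sub b0 bD]]]]] := halfline_bump hD.
have ab : a <= b by rewrite -subr_ge0 ba.
have mw : measurable_fun D (bump a b q p).
  apply: measurable_funD => //; apply: measurable_funM => //.
  exact: clamp_measurable.
have mI : measurable (`]a, b[%classic : set R) by exact: measurable_itv.
have mg : measurable_fun D (fun x => q * \1_`]a, b[ x).
  by apply: measurable_funM => //; exact: measurable_indic.
have gD x : D x -> `|q * \1_`]a, b[ x| <= \1_`]a, b[ x.
  by move=> _; rewrite normrM q1 mul1r ger0_norm.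
have [Lw nw] := L2norm2_scale_le c ba sub mw bD.
have [Lg ng] := L2norm2_scale_le c ba sub mg gD.
exists (fun x => (bump a b q p x)%:C%C *: c), (fun x => (q * \1_`]a, b[ x)%:C%C *: c).
split=> //; last by rewrite b0 scale1r.
split=> //; first exact: aeW.
apply/primitiveP => s t Ds Dt st e.
have ReE (r : R) : complex.Re '[r%:C%C *: c, e] = complex.Re '[c, e] * r.
  by rewrite ipZl !ReImE /=; ring.
rewrite -scalerBl -rmorphB ReE.
under eq_Rintegral do rewrite ReE.
have ind : mu.-integrable `]s, t[ (EFin \o (\1_`]a, b[ : R -> R)).
  by apply: integrableS (integrable_indic_itv a b false true).
have -> : bump a b q p t - bump a b q p s = q * (clamp a b t - clamp a b s).
  by rewrite /bump; ring.
by rewrite RintegralZl ?RintegralZl ?integral_clamp //; exact: integrable_scale ind.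
Qed.

(** The trace can be moved by any vector c at a cost of at most |c| in each of
    the norms of the function and of its derivative. The derivative of the
    shifted function is a choice in an almost everywhere class, and uniqueness
    of derivatives compares it with that of f. *)
Lemma H1_shift (f : R -> K) (c : K) : H1 D f -> exists f' : R -> K,
  [/\ H1 D f', trace0 D f' = trace0 D f + c,
    (L2norm2 D (f - f')%R <= (rnorm c ^+ 2)%:E)%E &
    (L2norm2 D ('i *: deriv D f - 'i *: deriv D f')%R <= (rnorm c ^+ 2)%:E)%E].
Proof.
move=> [Lf [w [g h]]]; have [b [b' [Lb hb b0 nb nb']]] := H1_bump c.
have h' := H1_derivative_comb hD 1 h hb.
exists (fun x => 1%:C%C *: f x + b x).
have aux (u v : K) : u - (1%:C%C *: u + v) = - v.
  by rewrite scale1r opprD addNKr.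
have iB (u v : K) : rnorm ('i *: u - 'i *: v) = rnorm (-1 *: v + u).
  rewrite -scalerBr rnormZ scaleN1r [- v + u]addrC -complexiE /=.
  by rewrite expr0n expr1n add0r sqrtr1 mul1r.
split.
- by split; [exact: L2_comb | eexists; eexists; exact: h'].
- by rewrite (trace0E hD h') (trace0E hD h) scale1r b0.
- apply: le_trans nb; rewrite /L2norm2 le_eqVlt; apply/orP; left; apply/eqP.
  by apply: eq_integral => x _; rewrite [(f - _) x]aux rnormN.
- apply: le_trans nb'; rewrite /L2norm2 le_eqVlt; apply/orP; left; apply/eqP.
  have [Ld dg] := derivE hD h; have [Ld' dg'] := derivE hD h'.
  transitivity (L2norm2 D (fun x => -1 *: deriv D (fun x => 1%:C%C *: f x + b x) x + deriv D f x)).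
    apply: eq_integral => x _; congr (_ ^+ 2)%:E.
    exact: iB.
  apply: ge0_ae_eq_integral => //; try by move=> x _; rewrite lee_fin sqr_ge0.
  - exact: (measurable_rnorm2 (strongly_measurable_comp2 (-1) Ld'.1 Ld.1)).
  - by case: hb => Lg _ _; exact: (measurable_rnorm2 Lg.1).
  - apply: (ae_imply _ (ae_and dg dg')) => x [e e'] Dx.
    by rewrite e // e' // scaleN1r scale1r opprD addrC addrA subrr add0r rnormN.
Qed.
End Shift.

(** * The core *)

Section Core.
Variables (R : realType) (H E Es : hilbertType R).
Variables (A : operator H) (G : H -> E) (Gs : H -> Es) (m l : R[i]).
Hypothesis A_maxdiss : maximal_dissipative A.
Hypothesis G_boundary : boundary_map A 'i G.
Hypothesis Gs_boundary : boundary_map (adjoint A) (- 'i) Gs.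
Hypothesis m_lower : complex.Im m < 0.
Hypothesis l_upper : 0 < complex.Im l.

Local Notation As := (adjoint A).
Local Notation S := (characteristic_function A G Gs).

Lemma star_rel_swap U h : star_rel A G Gs U h ->
  star_rel' A G Gs U (h - 'i *: U.1.2).
Proof. by case: U => -[vm u] vp [Dh Dhu eqp eqm]; split; rewrite ?subrK. Qed.

Lemma star_rel'_swap U hs : star_rel' A G Gs U hs ->
  star_rel A G Gs U (hs + 'i *: U.1.2).
Proof. by case: U => -[vm u] vp [Dh Dhu eqp eqm]; split; rewrite ?addrK. Qed.

(** The condition with h gives the one with h - i u in place of hs, and each of
    the two gives one half of the definition of the domain. *)
Lemma star_calC U h : H1_triples U -> star_rel A G Gs U h -> calC A G Gs m l U.
Proof.
move=> HU st; have := star_rel_swap st.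
case: U st HU => -[vm u] vp [Dh Dhu eqp eqm] [LU Hm Hp] [_ Dhu' _ eqp'].
have [Dr eqr] := (star_right A_maxdiss G_boundary Gs_boundary l_upper _ _ Dh).2
  (conj Dhu eqm).
have [Dl eql] := (star_left A_maxdiss G_boundary Gs_boundary m_lower _ _ Dhu).2
  (conj Dhu' eqp').
split; last by exists h.
split=> //; first by split; [rewrite eqm | rewrite eqp].
by split; [rewrite eql -eqm | rewrite eqr -eqp].
Qed.

Lemma calC_star U : calC A G Gs m l U ->
  H1_triples U /\ exists h, star_rel A G Gs U h.
Proof.
case: U => -[vm u] vp [[LU Hm Hp [_ Dr] [_ eqr]] [h Dh eqp]]; split=> //.
rewrite -eqp in Dr eqr.
have [Dhu eqm] := (star_right A_maxdiss G_boundary Gs_boundary l_upper _ _ Dh).1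
  (conj Dr eqr).
by exists h.
Qed.

Lemma calC_minus_star U : calC_minus A G Gs m l U ->
  H1_triples U /\ exists hs, star_rel' A G Gs U hs.
Proof.
case: U => -[vm u] vp [[LU Hm Hp [Dl _] [eql _]] [h Dh eqm]]; split=> //.
rewrite -eqm in Dl eql.
have [Dhu eqp] := (star_left A_maxdiss G_boundary Gs_boundary m_lower _ _ Dh).1
  (conj Dl eql).
by exists h.
Qed.

(** Keep p = u + (G (A + l)^-1)^adj v_+(0), which is in the domain of the
    adjoint, and replace the boundary value v_+(0) by a nearby G h. Then u, the
    trace v_-(0) given by (II) and the middle component of the image change by
    bounded operators applied to G h - v_+(0). The new triple satisfies the
    conditions of star_right, so it is in calC: condition (I) need not be
    arranged separately. *)
Lemma calC_core : is_core (calL_dom A G Gs m l) (calL A G m l) (calC A G Gs m l).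
Proof.
split=> [U []//|[[vm u] vp]] [LU Hm Hp [_ Dp] [_ eqm]] eps eps0.
set xp := vp@0+ in Dp eqm; set xm := vm@0- in eqm.
have l2 : 0 < complex.Im (- Num.conj l) by rewrite ImN Im_conj opprK.
have Bb := G_radj_bounded A_maxdiss G_boundary l_upper.
have [Sb _] := characteristic_functionP A_maxdiss G_boundary Gs_boundary l2.
set B := G_radj A G l in Bb Dp eqm; set T := S _ in Sb eqm.
have [MB MB0 MBP] := bounded_operator_le Bb.
have [MS MS0 MSP] := bounded_operator_le Sb.
pose n : R := Normc.normc (Num.conj l).
(* the six squared norms add up to at most d ^+ 2 * C *)
pose C := 2 * MS ^+ 2 + MB ^+ 2 + (n * MB) ^+ 2 + 2.
have C0 : 0 < C.
  have := sqr_ge0 MS; have := sqr_ge0 MB; have := sqr_ge0 (n * MB).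
  rewrite /C; lra.
pose d := eps / (C + 1).
have C1 : 0 < C + 1 by rewrite addr_gt0.
have d0 : 0 < d by rewrite divr_gt0.
have [_ _ Gd _] := G_boundary.
have [_ [h Dh <-] /ltW hx] := dense_approx Gd xp d0.
set p := u + B xp in Dp eqm.
pose c := G h - xp; rewrite -/c in hx.
pose u' := p - B (G h).
pose xm' := T (G h) - 'i *: Gs p.
have [vp' [Hp' tp' np ndp]] := H1_shift (or_intror erefl) c Hp.
have [vm' [Hm' tm' nm ndm]] := H1_shift (or_introl erefl) (xm' - xm) Hm.
rewrite -/xp /c addrC subrK in tp'; rewrite -/xm addrC subrK in tm'.
have pE : u' + B (G h) = p by rewrite /u' subrK.
have star : star_rel A G Gs (vm', u', vp') h.
  have [|Dq eqq] := (star_right A_maxdiss G_boundary Gs_boundary l_upper u' xm' Dh).1.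
    by rewrite -/B pE.
  by split=> //; rewrite tm'.
exists (vm', u', vp').
  by apply: star_calC star; split=> //; split; [case: Hm' | case: Hp'].
have cB : rnorm (B c) <= MB * d by apply: le_trans (MBP c) _; rewrite ler_wpM2l.
have uu : u - u' = B c.
  by rewrite /u' /p /c (bounded_operatorB Bb) opprB addrCA opprD addNKr.
have xx : xm' - xm = T c.
  by rewrite /xm' eqm /c (bounded_operatorB Sb) opprB addrA subrK.
have cS : rnorm (xm' - xm) <= MS * d.
  by rewrite xx; apply: le_trans (MSP c) _; rewrite ler_wpM2l.
have TT : (As p + Num.conj l *: B xp) - (As p + Num.conj l *: B (G h)) =
    - (Num.conj l *: B c).
  by rewrite opprD addrACA subrr add0r -scalerBr -scalerN /c
    (bounded_operatorB Bb) opprB.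
have nT : rnorm (- (Num.conj l *: B c)) <= n * (MB * d).
  by rewrite rnormN rnormZ ler_wpM2l // normc_ge0.
have sq (r s : R) : 0 <= r -> r <= s -> r ^+ 2 <= s ^+ 2.
  by move=> r0 rs; rewrite ler_pXn2r // nnegrE // (le_trans r0).
have -> : calHnorm2 ((vm, u, vp) - (vm', u', vp')) =
  (L2norm2 Rneg (vm - vm')%R + (rnorm (u - u') ^+ 2)%:E + L2norm2 Rpos (vp - vp')%R)%E by [].
have -> : calHnorm2 (calL A G m l (vm, u, vp) - calL A G m l (vm', u', vp')) =
  (L2norm2 Rneg ('i *: deriv Rneg vm - 'i *: deriv Rneg vm')%R +
   (rnorm (- (Num.conj l *: B c)) ^+ 2)%:E +
   L2norm2 Rpos ('i *: deriv Rpos vp - 'i *: deriv Rpos vp')%R)%E.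
  by rewrite -TT /calL /= tp' -/xp -/B pE.
apply: (@le_lt_trans _ _ (((MS * d) ^+ 2)%:E + ((MB * d) ^+ 2)%:E + (d ^+ 2)%:E +
   (((MS * d) ^+ 2)%:E + ((n * (MB * d)) ^+ 2)%:E + (d ^+ 2)%:E)))%E.
  rewrite uu; repeat apply: leeD.
  - by apply: le_trans nm _; rewrite lee_fin sq ?rnorm_ge0.
  - by rewrite lee_fin sq ?rnorm_ge0.
  - by apply: le_trans np _; rewrite lee_fin sq ?rnorm_ge0.
  - by apply: le_trans ndm _; rewrite lee_fin sq ?rnorm_ge0.
  - by rewrite lee_fin sq ?rnorm_ge0.
  - by apply: le_trans ndp _; rewrite lee_fin sq ?rnorm_ge0.
rewrite -!EFinD lte_fin.
have -> : (MS * d) ^+ 2 + (MB * d) ^+ 2 + d ^+ 2 +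
    ((MS * d) ^+ 2 + (n * (MB * d)) ^+ 2 + d ^+ 2) = d ^+ 2 * C by rewrite /C; ring.
have -> : eps = d * (C + 1) by rewrite /d divfK // gt_eqF.
have d2 : 0 < d ^+ 2 by rewrite exprn_gt0.
suff : d ^+ 2 * C < d ^+ 2 * (C + 1) ^+ 2 by rewrite -exprMn.
by rewrite ltr_pM2l //; have := mulr_gt0 C0 C0; nra.
Qed.
End Core.

Theorem theorem7p8 (R : realType) (H E Es : hilbertType R)
    (A : operator H) (G : H -> E) (Gs : H -> Es) (m l : R[i])
    (A_maxdiss : maximal_dissipative A)
    (G_boundary : boundary_map A 'i G)
    (Gs_boundary : boundary_map (adjoint A) (- 'i) Gs)
    (m_lower : complex.Im m < 0) (l_upper : 0 < complex.Im l) :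
  [/\ is_core (calL_dom A G Gs m l) (calL A G m l) (calC A G Gs m l),
      [/\ calC A G Gs m l = calC_minus A G Gs m l,
          calC A G Gs m l =
            [set U | H1_triples U /\ exists h, star_rel A G Gs U h] &
          calC A G Gs m l =
            [set U | H1_triples U /\ exists hs, star_rel' A G Gs U hs]] &
      forall (vm : R -> Es) (u : H) (vp : R -> E) (h : H),
        calC A G Gs m l (vm, u, vp) ->
        star_rel A G Gs (vm, u, vp) h ->
        calL A G m l (vm, u, vp) =
          ('i *: deriv Rneg vm,
           'i *: (adjoint A (h - 'i *: u) - A h),
           'i *: deriv Rpos vp)].
Proof.
have toC U h : H1_triples U -> star_rel A G Gs U h -> calC A G Gs m l U.
  exact: star_calC.
have fromC U : calC A G Gs m l U -> H1_triples U /\ exists h, star_rel A G Gs U h.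
  exact: calC_star.
split; first exact: calC_core.
  split; apply/seteqP; split=> U.
  - move=> CU; have [HU [h st]] := fromC U CU; split; first exact: CU.1.
    case: U st {CU HU} => -[vm u] vp [Dh Dhu eqp eqm].
    by exists (h - 'i *: u).
  - move=> CU; have [HU [hs /star_rel'_swap st]] :=
      calC_minus_star A_maxdiss G_boundary Gs_boundary m_lower CU.
    exact: toC st.
  - exact: fromC.
  - by move=> [HU [h st]]; exact: toC st.
  - move=> /fromC[HU [h /star_rel_swap st]]; split=> //; eexists; exact: st.
  - by move=> [HU [hs /star_rel'_swap st]]; exact: toC st.
move=> vm u vp h _ [Dh Dhu eqp eqm]; rewrite /calL eqp.
by rewrite (calL_star A_maxdiss G_boundary Gs_boundary l_upper Dh Dhu).
Qed.
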